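(* For all integers $n\ge 0$, $$\bar{p}(135n+63)\equiv \bar{p}(135n+117)\equiv 0\pmod{40}.$$
   Context: An overpartition of a nonnegative integer $n$ is a partition of $n$ in which the first occurrence of each part size may or may not be overlined (marked). $\bar{p}(n)$ denotes the number of overpartitions of $n$ (for example $\bar{p}(3)=8$). Its generating function is $$\sum_{n=0}^{\infty}\bar{p}(n)q^n = \frac{(q^2;q^2)_{\infty}}{(q;q)_{\infty}^2},$$ where $(q^a;q^b)_{\infty} := \prod_{m=0}^{\infty}(1-q^{bm+a})$. *)

(* Defs.v *)
From mathcomp Require Import all_boot.

Set Implicit Arguments.
Unset Strict Implicit.
Unset Printing Implicit Defensive.

(* An overpartition is written as the list of its parts in nonincreasing order,
   each part paired with a boolean that is true when the part is overlined.  In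
   the last clause, index gives the position of the first occurrence, so only
   the first occurrence of each part size can be overlined. *)
Definition is_overpartition (n : nat) (s : seq (nat * bool)) : bool :=
  let parts := unzip1 s in
  let marks := unzip2 s in
  [&& all (fun k => 0 < k) parts,
      sorted geq parts,
      sumn parts == n
    & [forall i : 'I_(size s),
         nth false marks i ==> (index (nth 0 parts i) parts == i)]].

Definition forget_bounds (n : nat) (s : n.-bseq ('I_n.+1 * bool)) :
  seq (nat * bool) := [seq (val x.1, x.2) | x <- s].

(* The parts of an overpartition of n, and their number, are at most n, so all
   overpartitions of n are found in a finite type of bounded sequences; see
   forget_bounds_inj and overpartition_bounded. *)
Definition overp (n : nat) : nat :=
  #|[set s : n.-bseq ('I_n.+1 * bool) | is_overpartition n (forget_bounds s)]|.

Lemma forget_bounds_inj (n : nat) : injective (@forget_bounds n).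
Proof.
move=> s t eq_st; apply/val_inj; move: eq_st; apply: inj_map.
by move=> [i b] [j c] /= [/val_inj -> ->].
Qed.

Lemma overpartition_bounded (n : nat) (s : seq (nat * bool)) :
  is_overpartition n s ->
  exists t : n.-bseq ('I_n.+1 * bool), s = forget_bounds t.
Proof.
case/and4P=> pos_s _ /eqP sum_s _.
have le_size : size s <= n.
  rewrite -sum_s; elim: s pos_s {sum_s} => //= x s IHs /andP[x_gt0 /IHs le_s].
  by rewrite -add1n leq_add.
have le_part x : x \in s -> x.1 <= n.
  rewrite -sum_s; elim: s {pos_s sum_s le_size} => //= y s IHs.
  rewrite inE => /predU1P[-> | /IHs le_x]; first exact: leq_addr.
  exact: leq_trans le_x (leq_addl _ _).
pose t := [seq (inord x.1 : 'I_n.+1, x.2) | x <- s].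
have size_t : size t <= n by rewrite size_map.
exists (Bseq size_t); rewrite /forget_bounds /= -map_comp -[LHS]map_id.
apply/eq_in_map => -[k b] /le_part /= le_k.
by rewrite inordK.
Qed.

(* Main.v *)
Require Import Defs.
From HB Require Import structures.
From mathcomp Require Import all_boot all_order all_algebra.
From mathcomp Require Import boolp.
From mathcomp Require Import ring zify.

(** Let phi(q) be the sum of q^(x^2) over all integers x.  Gauss's product for
    phi gives
      sum_n (-1)^n overp(n) q^n = 1 / phi(q)                     (theta_overp),
    so everything is about the reciprocal of phi.  Both arguments of the theorem
    have the form 9 k with k = 1 modulo 3 and k = 2 or 3 modulo 5, and
    40 = 8 * 5.

    Modulo 8.  Write phi = 1 + 2 psi.  Then 1 / phi = 1 - 2 psi + 4 psi^2, and
    psi^2 = psi(q^2) modulo 2, so 8 divides overp(n) unless n is a square or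
    twice a square (dvdn_overp8).  Squares are excluded for 9 k modulo 5, and
    doubles of squares are excluded for k modulo 3.

    Modulo 5.  Split phi = a + z with a = phi(q^9), where z has only exponents
    equal to 1 modulo 3, and put c = phi(q^3).  The relation
      c^4 = a (a^3 + z^3)                                        (phi_cubic)
    turns 1 / phi into a (a^2 - a z + z^2) / c^4, which shows its residue
    classes modulo 3; applying this twice gives
      sum_n (-1)^n overp(9 n) q^n
        = 27 c^12 / phi^13 - 36 c^8 / phi^9 + 10 c^4 / phi^5     (every9_recip).
    Since h^5 = h(q^5) modulo 5 for every series h, the part of this series with
    exponents equal to 1 modulo 3 is a rational expression in a, c and z.  It
    simplifies thanks to an algebraic relation that holds only modulo 5: with
    C = c^4 and G = a^4,
      (C^2 + G^2) (C^2 - 2 C G - G^2) = C G              (theta_level3_mod5).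
    The outcome is (every9_recip_class1)
      - (2 a^30 z + a^15 z^16 + a^21 z^10) / c^40,
    where every term is a fifth power times a or z.  Fifth powers only have
    exponents divisible by 5, and those of a and z are squares; hence no
    exponent equal to 2 or 3 modulo 5 occurs, which is the claim.

    The relation modulo 5 comes from a differential equation.  Let D = q d/dq.
    Since x^4 = 1 modulo 5 for x prime to 5, D^2 phi = phi - phi^25.  Splitting
    the integers x into the classes 0, 1 and -1, 2 and -2 modulo 5, the identity
    phi(q^5)^2 - phi(q^25)^2 = f g, where f and g are the theta series of the two
    nonzero pairs of classes, gives a first integral:
      (D phi)^2 = phi^2 + phi^10 - 2 phi^26                  (qderiv_phi_sq).
    Its three components modulo 3 express (D a)^2, D a D z and (D z)^2 as
    polynomials in a and z, and D^2 applied to phi_cubic then becomes a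
    polynomial relation between C and G.  That polynomial is the relation above
    times a factor with nonzero constant term, which can be cancelled.

    The two identities between theta functions used here, phi_cubic and the one
    for f g, express that multiplication by a matrix M with M M^T = 3 or
    M M^T = 5 maps the cubic lattice of dimension 4 or 2 onto the sublattice of
    vectors whose reduction modulo 3 or 5 lies in a self-dual code. *)

Set Implicit Arguments.
Unset Strict Implicit.
Unset Printing Implicit Defensive.

Import GRing.Theory.
Local Open Scope ring_scope.

(** * Formal power series *)

Record fps (R : Type) := Fps { coef :> nat -> R }.

Section FpsRing.
Variable R : comNzRingType.
Implicit Types (f g h : fps R) (n N : nat).

HB.instance Definition _ := gen_eqMixin (fps R).
HB.instance Definition _ := gen_choiceMixin (fps R).

Lemma fpsP f g : (forall n, f n = g n) -> f = g.
Proof. by case: f g => [f] [g] /= /funext ->. Qed.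

Definition fps_add f g := Fps (fun n => f n + g n).
Definition fps_opp f := Fps (fun n => - f n).
Definition fps_mul f g := Fps (fun n => \sum_(i < n.+1) f i * g (n - i)%N).
Definition fps_const (c : R) := Fps (fun n => if n == 0%N then c else 0).

Fact fps_addA : associative fps_add.
Proof. by move=> f g h; apply: fpsP => n /=; rewrite addrA. Qed.
Fact fps_addC : commutative fps_add.
Proof. by move=> f g; apply: fpsP => n /=; rewrite addrC. Qed.
Fact fps_add0 : left_id (fps_const 0) fps_add.
Proof. by move=> f; apply: fpsP => n /=; rewrite if_same add0r. Qed.
Fact fps_addN : left_inverse (fps_const 0) fps_opp fps_add.
Proof. by move=> f; apply: fpsP => n /=; rewrite if_same addNr. Qed.

HB.instance Definition _ :=
  GRing.isZmodule.Build (fps R) fps_addA fps_addC fps_add0 fps_addN.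

(** Below a given order, products of series are products of polynomials, so the
    ring axioms are inherited from those of polynomials. *)
Definition fps_trunc N f := \poly_(i < N) f i.

Lemma fps_mul_trunc N f g n :
  (n < N)%N -> fps_mul f g n = (fps_trunc N f * fps_trunc N g)`_n.
Proof.
move=> ltnN; rewrite coefM /=; apply: eq_bigr => i _.
have lei : (i <= n)%N by rewrite -ltnS.
by rewrite !coef_poly (leq_ltn_trans lei ltnN) (leq_ltn_trans (leq_subr _ _) ltnN).
Qed.

Lemma fps_trunc_mul N f g n :
  (n < N)%N ->
  (fps_trunc N (fps_mul f g))`_n = (fps_trunc N f * fps_trunc N g)`_n.
Proof. by move=> ltnN; rewrite coef_poly ltnN (fps_mul_trunc _ _ ltnN). Qed.

Fact fps_mulC : commutative fps_mul.
Proof.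
by move=> f g; apply: fpsP => n; rewrite !(fps_mul_trunc _ _ (ltnSn n)) mulrC.
Qed.

Fact fps_mulA : associative fps_mul.
Proof.
move=> f g h; apply: fpsP => n.
have low (p p' r r' : {poly R}) : (forall i, (i < n.+1)%N -> p`_i = p'`_i) ->
    (forall i, (i < n.+1)%N -> r`_i = r'`_i) -> (p * r)`_n = (p' * r')`_n.
  move=> ep er; rewrite !coefM; apply: eq_bigr => i _.
  by rewrite ep // er // ltnS leq_subr.
rewrite !(fps_mul_trunc _ _ (ltnSn n)).
rewrite (low _ _ _ _ (fun _ _ => erefl) (@fps_trunc_mul n.+1 g h)) mulrA.
by apply: low => // i lti; rewrite -fps_trunc_mul.
Qed.

Fact fps_mul1 : left_id (fps_const 1) fps_mul.
Proof.
move=> f; apply: fpsP => n /=; rewrite big_ord_recl /= subn0 mul1r big1 ?addr0 //.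
by move=> i _; rewrite mul0r.
Qed.

Fact fps_mulDl : left_distributive fps_mul fps_add.
Proof.
move=> f g h; apply: fpsP => n /=; rewrite -big_split /=.
by apply: eq_bigr => i _; rewrite mulrDl.
Qed.

Fact fps_1neq0 : fps_const 1 != 0.
Proof.
apply/eqP => /(congr1 (fun f : fps R => f 0%N)) /= e10.
by have := oner_neq0 R; rewrite e10 eqxx.
Qed.

HB.instance Definition _ := GRing.Zmodule_isComNzRing.Build (fps R)
  fps_mulA fps_mulC fps_mul1 fps_mulDl fps_1neq0.

Lemma fpsD f g n : (f + g) n = f n + g n. Proof. by []. Qed.
Lemma fpsN f n : (- f) n = - f n. Proof. by []. Qed.
Lemma fpsB f g n : (f - g) n = f n - g n. Proof. by []. Qed.
Lemma fps0 n : (0 : fps R) n = 0. Proof. by rewrite /= if_same. Qed.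
Lemma fps1 n : (1 : fps R) n = (n == 0%N)%:R. Proof. by rewrite /=; case: eqP. Qed.
Lemma fpsM f g n : (f * g) n = \sum_(i < n.+1) f i * g (n - i)%N.
Proof. by []. Qed.

Lemma fps_sum I r (P : pred I) (F : I -> fps R) n :
  (\sum_(i <- r | P i) F i) n = \sum_(i <- r | P i) F i n.
Proof. by elim/big_rec2: _ => [|i x f _ <-]; rewrite ?fps0 ?fpsD. Qed.

Lemma fpsMn f k n : (f *+ k) n = f n *+ k.
Proof. by elim: k => [|k IHk]; rewrite ?mulr0n ?fps0 // !mulrS fpsD IHk. Qed.

Definition fpsX : fps R := Fps (fun n => (n == 1%N)%:R).

Lemma fpsXM f n : (fpsX * f) n = if n is m.+1 then f m else 0.
Proof.
rewrite fpsM; case: n => [|n]; first by rewrite big_ord_recl big_ord0 mul0r addr0.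
rewrite big_ord_recl mul0r add0r big_ord_recl mul1r subSS subn0 big1 ?addr0 //.
by move=> i _; rewrite mul0r.
Qed.

Lemma fpsXnM k f n : (fpsX ^+ k * f) n = if (k <= n)%N then f (n - k)%N else 0.
Proof.
elim: k n => [|k IHk] n; first by rewrite mul1r subn0.
by rewrite exprS -mulrA fpsXM; case: n => // n; rewrite IHk ltnS subSS.
Qed.

Lemma fpsXn k n : (fpsX ^+ k) n = (n == k)%:R.
Proof.
rewrite -[_ ^+ k]mulr1 fpsXnM; case: leqP => [lekn|ltnk]; last by rewrite ltn_eqF.
by rewrite fps1 subn_eq0 eqn_leq lekn andbT.
Qed.

(** Congruence modulo q^N. *)
Definition eq_below N f g := forall n, (n < N)%N -> f n = g n.

Lemma eq_belowM N f1 f2 g1 g2 :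
  eq_below N f1 f2 -> eq_below N g1 g2 -> eq_below N (f1 * g1) (f2 * g2).
Proof.
move=> ef eg n ltnN; rewrite !fpsM; apply: eq_bigr => i _.
have lei : (i <= n)%N by rewrite -ltnS.
by rewrite ef ?eg ?(leq_ltn_trans lei) // (leq_ltn_trans (leq_subr _ _)).
Qed.

Lemma eq_belowP f g : (forall N, eq_below N f g) -> f = g.
Proof. by move=> efg; apply: fpsP => n; apply: (efg n.+1). Qed.

(** ** Substitution of q^m for q, and multisection *)

Definition subXn m f := Fps (fun n => if (m %| n)%N then f (n %/ m)%N else 0).
Definition every m f := Fps (fun n => f (m * n)%N).

Lemma subXnE m f n : subXn m f n = if (m %| n)%N then f (n %/ m)%N else 0.
Proof. by []. Qed.

(** In the coefficient of q^(m n) only the indices divisible by m survive, which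
    is a convolution again. *)
Lemma every_subXnM m f g : (0 < m)%N -> every m (subXn m f * g) = f * every m g.
Proof.
move=> m0; apply: fpsP => n; rewrite [LHS]fpsM [RHS]fpsM /=.
rewrite (eq_bigr (fun i : 'I__ => if (m %| i)%N then f (i %/ m)%N * g (m * n - i)%N
                                  else 0)); last first.
  by move=> i _; case: ifP => // _; rewrite mul0r.
rewrite -big_mkcond /=.
rewrite (reindex_onto (fun i : 'I_n.+1 => inord (m * i) : 'I_(m * n).+1)
                      (fun j : 'I_(m * n).+1 => inord (j %/ m))) /=.
  have val_i (i : 'I_n.+1) : (inord (m * i) : 'I_(m * n).+1) = (m * i)%N :> nat.
    by rewrite inordK // ltnS leq_pmul2l // -ltnS; exact: ltn_ord.
  apply: eq_big => [i|i _].
    by rewrite val_i dvdn_mulr // mulKn // inord_val eqxx.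
  by rewrite val_i mulKn // mulnBr.
move=> j /dvdnP[k ejk]; apply: val_inj => /=.
have lek : (k < n.+1)%N by rewrite ltnS -(leq_pmul2l m0) mulnC -ejk -ltnS; exact: ltn_ord.
by rewrite ejk mulnK // [inord k]/= !inordK // mulnC -?ejk.
Qed.

Lemma every_subXn m f : (0 < m)%N -> every m (subXn m f) = f.
Proof. by move=> m0; apply: fpsP => n /=; rewrite dvdn_mulr // mulKn. Qed.

Lemma subXnM m f g : (0 < m)%N -> subXn m (f * g) = subXn m f * subXn m g.
Proof.
move=> m0; apply: fpsP => n; case: (boolP (m %| n)%N) => [/dvdnP[k ->]|ndv].
  have := congr1 (fun h : fps R => h k) (every_subXnM f (subXn m g) m0).
  by rewrite every_subXn //= dvdn_mull // mulnK // mulnC => ->.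
rewrite [LHS]/= (negbTE ndv) fpsM big1 // => i _ /=.
case: ifP => [dvi|_]; last by rewrite mul0r.
have lei : (i <= n)%N by rewrite -ltnS.
by rewrite dvdn_subl // (negbTE ndv) mulr0.
Qed.

Lemma subXnD m f g : subXn m (f + g) = subXn m f + subXn m g.
Proof. by apply: fpsP => n /=; case: ifP => // _; rewrite addr0. Qed.

Lemma subXnN m f : subXn m (- f) = - subXn m f.
Proof. by apply: fpsP => n /=; case: ifP => // _; rewrite oppr0. Qed.

Lemma subXn1 m : (0 < m)%N -> subXn m 1 = 1.
Proof.
move=> m0; apply: fpsP => -[|n] /=; first by rewrite dvdn0 div0n.
by case: ifP => // dv; rewrite -leqn0 leqNgt divn_gt0 // dvdn_leq.
Qed.
End FpsRing.

Section FpsTheory.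
Variable R : comNzRingType.
Implicit Types (f g h : fps R) (m n r s : nat).

(** A series with constant term 1 can be cancelled modulo any power of q. *)
Lemma fps_mul_low N f g :
  f 0%N = 1 -> eq_below N (f * g) 0 -> eq_below N g 0.
Proof.
move=> f0 fg0 n; rewrite fps0; elim/ltn_ind: n => n IHn ltnN.
have := fg0 n ltnN; rewrite fps0 fpsM big_ord_recl.
rewrite f0 mul1r subn0 big1 ?addr0 // => i _.
have lti : (n - lift ord0 i < n)%N by rewrite lift0 subnSK // leq_subr.
by rewrite IHn ?mulr0 // (ltn_trans lti).
Qed.

Lemma fps_mul_eq0 f g : f 0%N = 1 -> f * g = 0 -> g = 0.
Proof.
move=> f0 fg0; apply: eq_belowP => N; apply: (fps_mul_low f0).
by rewrite fg0.
Qed.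

Lemma fps_mulI f g h : f 0%N = 1 -> f * g = f * h -> g = h.
Proof.
move=> f0 e; apply/eqP; rewrite -subr_eq0; apply/eqP/(fps_mul_eq0 f0).
by rewrite mulrBr e subrr.
Qed.

Lemma fps_mul0 f g : (f * g) 0%N = f 0%N * g 0%N.
Proof. by rewrite fpsM big_ord_recl big_ord0 addr0. Qed.

Lemma fps_exp0 f n : (f ^+ n) 0%N = f 0%N ^+ n.
Proof. by elim: n => [|n IHn]; rewrite ?fps1 // !exprS fps_mul0 IHn. Qed.

(** ** The derivation q d/dq *)

Definition qderiv f := Fps (fun n => n%:R * f n).

Lemma qderivE f n : qderiv f n = n%:R * f n. Proof. by []. Qed.

Lemma qderivD f g : qderiv (f + g) = qderiv f + qderiv g.
Proof. by apply: fpsP => n /=; rewrite mulrDr. Qed.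

Lemma qderivM f g : qderiv (f * g) = qderiv f * g + f * qderiv g.
Proof.
apply: fpsP => n; rewrite qderivE fpsM mulr_sumr fpsD !fpsM -big_split.
apply: eq_bigr => i _ /=.
have lei : (i <= n)%N by rewrite -ltnS.
by rewrite -{1}(subnKC lei) natrD; ring.
Qed.

Lemma qderiv_subXn m f : (0 < m)%N -> qderiv (subXn m f) = subXn m (qderiv f) *+ m.
Proof.
move=> m0; apply: fpsP => n; rewrite fpsMn /=; case: ifP => dv; last first.
  by rewrite mulr0 mul0rn.
by rewrite -{1}(divnK dv) natrM -mulr_natl; ring.
Qed.

(** ** Series supported on one residue class *)

Definition supported m r f := forall n, n != r %[mod m] -> f n = 0.

Lemma supported_eqmod m r s f : r = s %[mod m] -> supported m r f -> supported m s f.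
Proof. by move=> ers sf n ns; apply: sf; rewrite ers. Qed.

Lemma supportedD m r f g : supported m r f -> supported m r g -> supported m r (f + g).
Proof. by move=> sf sg n ns; rewrite fpsD sf // sg // addr0. Qed.

Lemma supportedN m r f : supported m r f -> supported m r (- f).
Proof. by move=> sf n ns; rewrite fpsN sf // oppr0. Qed.

Lemma supportedM m r s f g :
  supported m r f -> supported m s g -> supported m (r + s) (f * g).
Proof.
move=> sf sg n ns; rewrite fpsM big1 // => i _.
case: (eqVneq (i %% m)%N (r %% m)%N) => [er|]; last by move/sf->; rewrite mul0r.
case: (eqVneq ((n - i) %% m)%N (s %% m)%N) => [es|]; last by move/sg->; rewrite mulr0.
have lei : (i <= n)%N by rewrite -ltnS.
by case/eqP: ns; rewrite -(subnKC lei) -modnDm er es modnDm.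
Qed.

Lemma supportedMn m r f k : supported m r f -> supported m r (f *+ k).
Proof. by move=> sf n ns; rewrite fpsMn sf // mul0rn. Qed.

Lemma supported_nat m k : supported m 0 (k%:R : fps R).
Proof.
move=> n ns; rewrite fpsMn fps1; have [n0|_] := eqVneq n 0%N; last by rewrite mul0rn.
by rewrite n0 eqxx in ns.
Qed.

Lemma supportedX m r k f : supported m r f -> supported m (r * k) (f ^+ k).
Proof.
move=> sf; elim: k => [|k IHk]; first by rewrite muln0; exact: (@supported_nat m 1).
by rewrite mulnS exprS; apply: supportedM.
Qed.

Lemma supported_subXn m f : (0 < m)%N -> supported m 0 (subXn m f).
Proof.
by move=> m0 n; rewrite mod0n -lt0n /= /dvdn => /prednK <-.
Qed.

Lemma supported_qderiv m r f : supported m r f -> supported m r (qderiv f).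
Proof. by move=> sf n ns /=; rewrite sf // mulr0. Qed.

Lemma supported3_inj f0 f1 f2 g0 g1 g2 :
  supported 3 0 f0 -> supported 3 1 f1 -> supported 3 2 f2 ->
  supported 3 0 g0 -> supported 3 1 g1 -> supported 3 2 g2 ->
  f0 + f1 + f2 = g0 + g1 + g2 -> [/\ f0 = g0, f1 = g1 & f2 = g2].
Proof.
move=> sf0 sf1 sf2 sg0 sg1 sg2 e.
have en n : f0 n + f1 n + f2 n = g0 n + g1 n + g2 n.
  by have := congr1 (fun h : fps R => h n) e.
have mod3 n : [\/ n = 0 %[mod 3], n = 1 %[mod 3] | n = 2 %[mod 3]].
  have := ltn_pmod n (isT : (0 < 3)%N).
  by case: (n %% 3)%N => [|[|[|]]] // _; [constructor 1|constructor 2|constructor 3].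
split; apply: fpsP => n; have := en n; case: (mod3 n) => nr.
- by rewrite (sf1 n) ?(sf2 n) ?(sg1 n) ?(sg2 n) ?nr // !addr0.
- by rewrite (sf0 n) ?(sg0 n) ?nr.
- by rewrite (sf0 n) ?(sg0 n) ?nr.
- by rewrite (sf1 n) ?(sg1 n) ?nr.
- by rewrite (sf0 n) ?(sf2 n) ?(sg0 n) ?(sg2 n) ?nr // !addr0 !add0r.
- by rewrite (sf1 n) ?(sg1 n) ?nr.
- by rewrite (sf2 n) ?(sg2 n) ?nr.
- by rewrite (sf2 n) ?(sg2 n) ?nr.
- by rewrite (sf0 n) ?(sf1 n) ?(sg0 n) ?(sg1 n) ?nr // !add0r.
Qed.

Lemma every_supported m r f :
  (0 < m)%N -> supported m r f -> r != 0 %[mod m] -> every m f = 0.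
Proof.
by move=> m0 sf r0; apply: fpsP => n; rewrite fps0 /= sf // modnMr eq_sym -(mod0n m).
Qed.

Lemma everyD m f g : every m (f + g) = every m f + every m g.
Proof. by []. Qed.
End FpsTheory.

(** ** The Frobenius endomorphism *)

Lemma frobeniusD (A : comNzRingType) (p c : nat) (x y : A) :
  prime p -> (c * p)%:R = 0 :> A -> (x + y) ^+ p *+ c = (x ^+ p + y ^+ p) *+ c.
Proof.
case: p => // p p_pr cp0; rewrite exprDn big_ord_recl big_ord_recr /=.
rewrite bin0 subn0 expr0 mulr1 subnn expr0 mul1r mulr1n /bump /= binn mulr1n.
rewrite !mulrnDl -sumrMnl big1 ?add0r // => i _.
have /dvdnP[k ->] : (p.+1 %| 'C(p.+1, i.+1))%N.
  by apply: prime_dvd_bin => //=; exact: ltn_ord.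
by rewrite -mulrnA -mulnA [(p.+1 * c)%N]mulnC mulnC mulrnA -[X in X *+ k]mulr_natr cp0 mulr0 mul0rn.
Qed.

(** Induction on the coefficient: split off the constant term of f and apply the
    additivity of the p-th power to f = f_0 + q t.  The multiplier c covers two
    cases at once: p = 5, c = 1 over F_5, and p = 2, c = 4 modulo 8, where only
    squares multiplied by 4 are additive. *)
Lemma fps_frobenius (R : comNzRingType) (p c : nat) (f : fps R) :
  prime p -> (c * p)%:R = 0 :> R -> (forall n, f n ^+ p = f n) ->
  f ^+ p *+ c = subXn p f *+ c.
Proof.
move=> p_pr cp0 fp; have p0 := prime_gt0 p_pr.
have cp0' : (c * p)%:R = 0 :> fps R.
  by apply: fpsP => n; rewrite fpsMn fps1 fps0; case: eqP => // _; rewrite mul0rn.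
apply: fpsP => n; elim/ltn_ind: n f fp => n IHn f fp.
pose t := Fps (fun n => f n.+1).
have -> : f = fps_const (f 0%N) + fpsX R * t.
  by apply: fpsP => -[|k]; rewrite fpsD fpsXM /= ?addr0 ?add0r.
have cX k (a : R) : fps_const a ^+ k = fps_const (a ^+ k).
  elim: k => [|k IHk]; first exact: fpsP.
  rewrite !exprS IHk; apply: fpsP => i; rewrite fpsM big_ord_recl /= subn0.
  rewrite big1 ?addr0 => [|j _]; last by rewrite mul0r.
  by case: eqP; rewrite ?mulr0.
rewrite frobeniusD // cX fp exprMn !fpsMn !fpsD fpsXnM mulrnDl.
have [lepn|ltnp] := leqP p n; last first.
  rewrite mul0rn addr0 subXnE; case: n {IHn} ltnp => [|n] ltnp.
    by rewrite dvdn0 div0n fpsD fpsXM addr0.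
  by case: ifP => // /(dvdn_leq (ltn0Sn n)); rewrite leqNgt ltnp.
have n0 : (0 < n)%N := leq_trans p0 lepn.
have tp k : t k ^+ p = t k by apply: fp.
have := IHn (n - p)%N _ t tp; rewrite !fpsMn => -> //; last by rewrite ltn_subrL n0 p0.
have nE : (n %/ p = ((n - p) %/ p).+1)%N.
  by rewrite -{1}(subnK lepn) divnDr // divnn p0 addn1.
have -> : fps_const (f 0%N) n = 0 by rewrite /= gtn_eqF.
by rewrite mul0rn add0r !subXnE dvdn_subl // nE fpsD fpsXM add0r.
Qed.

Section SubXn.
Variables (R : comNzRingType) (m : nat).
Hypothesis m0 : (0 < m)%N.
Implicit Types f g : fps R.

Lemma subXnX f k : subXn m (f ^+ k) = subXn m f ^+ k.
Proof.
by elim: k => [|k IHk]; rewrite ?subXn1 // !exprS subXnM // IHk.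
Qed.

Lemma subXnMn f k : subXn m (f *+ k) = subXn m f *+ k.
Proof.
apply: fpsP => n; rewrite !subXnE !fpsMn subXnE; case: ifP => // _.
by rewrite mul0rn.
Qed.

Lemma subXn_subXn n f : (0 < n)%N -> subXn m (subXn n f) = subXn (m * n) f.
Proof.
move=> n0; apply: fpsP => k; rewrite !subXnE.
have [/dvdnP[j ->]|ndv] := boolP (m %| k)%N.
  by rewrite mulnK // [(j * m)%N]mulnC dvdn_pmul2l // divnMl.
by case: ifP => // /(dvdn_trans (dvdn_mulr n (dvdnn m))); rewrite (negbTE ndv).
Qed.

Lemma qderiv_supported r f :
  m%:R = 0 :> R -> supported m r f -> qderiv f = f *+ r.
Proof.
move=> mR sf; apply: fpsP => n; rewrite qderivE fpsMn.
have [e|/sf ->] := eqVneq (n %% m)%N (r %% m)%N; last by rewrite mulr0 mul0rn.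
rewrite -[RHS]mulr_natl; congr (_ * _).
by rewrite (divn_eq n m) (divn_eq r m) e !natrD !natrM mR !mulr0.
Qed.
End SubXn.

(** * Theta series *)

Definition ints (N : nat) : seq int := [seq i%:Z - N%:Z | i <- iota 0 N.*2.+1].

Lemma ints_uniq N : uniq (ints N).
Proof. by rewrite map_inj_uniq ?iota_uniq // => i j; lia. Qed.

Lemma mem_ints N x : (x \in ints N) = (`|x| <= N)%N.
Proof.
apply/mapP/idP => [[i] | le_xN]; first by rewrite mem_iota; lia.
by exists (absz (x + N%:Z)); rewrite ?mem_iota; lia.
Qed.

Definition sqz (x : int) : nat := (`|x| ^ 2)%N.

Lemma sqzE x : (sqz x)%:Z = x ^+ 2.
Proof. by rewrite /sqz -abszX; lia. Qed.

Lemma sqzN x : sqz (- x) = sqz x.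
Proof. by rewrite /sqz abszN. Qed.

Lemma leq_sqz x : (`|x| <= sqz x)%N.
Proof. by rewrite /sqz; case: `|x|%N => // k; rewrite expnS expn1 leq_pmulr. Qed.

Definition pairs (T : Type) (s : seq T) := [seq (x, y) | x <- s, y <- s].

Lemma pairs_uniq (T : eqType) (s : seq T) : uniq s -> uniq (pairs s).
Proof. by move=> us; apply: allpairs_uniq => // -[a b] [c d]. Qed.

Lemma mem_pairs (T : eqType) (s : seq T) (v : T * T) :
  (v \in pairs s) = (v.1 \in s) && (v.2 \in s).
Proof.
apply/allpairsP/andP => [[[a b] /= [sa sb ->]] //|[s1 s2]].
by exists v; case: v s1 s2.
Qed.

Section ThetaSeries.
Variable R : comNzRingType.
Implicit Types (P : pred int) (N n m : nat).
Local Notation X := (fpsX R).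

Lemma vector_sum_count (T : Type) (s : seq T) (P : pred T) (Q : T -> nat) n :
  (\sum_(v <- s | P v) X ^+ Q v) n = (count (fun v => P v && (Q v == n)) s)%:R.
Proof.
elim: s => [|v s IHs]; first by rewrite big_nil fps0.
rewrite big_cons [count _ _]/= natrD -IHs; case: (P v); last by rewrite add0r.
by rewrite fpsD fpsXn eq_sym.
Qed.

(** A norm-preserving bijection between two families of vectors identifies the
    generating series of the norms; only vectors of norm n matter for the
    coefficient of q^n, so that finite boxes of vectors suffice. *)
Lemma vector_sum_bij (T T' : eqType) (s : seq T) (s' : seq T')
    (P : pred T) (P' : pred T') (Q : T -> nat) (Q' : T' -> nat) (f : T -> T') n :
  uniq s -> uniq s' ->
  (forall v, Q v = n -> v \in s) -> (forall v, Q' v = n -> v \in s') ->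
  injective f -> (forall v, Q' (f v) = Q v) ->
  (forall v, P v -> P' (f v)) -> (forall v', P' v' -> exists2 v, P v & v' = f v) ->
  (\sum_(v <- s | P v) X ^+ Q v) n = (\sum_(v <- s' | P' v) X ^+ Q' v) n.
Proof.
move=> us us' cs cs' inj_f QQ' PP' P'P.
rewrite !vector_sum_count -!size_filter; congr (_%:R).
rewrite -(size_map f); apply/perm_size/uniq_perm.
- by rewrite map_inj_uniq ?filter_uniq.
- exact: filter_uniq.
move=> v'; rewrite mem_filter -andbA; apply/mapP/and3P => [[v]|[P'v /eqP Qv _]].
  rewrite mem_filter => /andP[/andP[Pv /eqP Qv] _] ->.
  by split; rewrite ?PP' ?QQ' ?Qv // cs' // QQ'.
have [v Pv ev] := P'P _ P'v; exists v => //.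
by rewrite mem_filter Pv -QQ' -ev Qv eqxx cs // -QQ' -ev.
Qed.

Lemma vector_sum_mul (T : Type) (s : seq T) (P P' : pred T) (Q Q' : T -> nat) :
  (\sum_(v <- s | P v) X ^+ Q v) * (\sum_(v <- s | P' v) X ^+ Q' v) =
  \sum_(v <- pairs s | P v.1 && P' v.2) X ^+ (Q v.1 + Q' v.2).
Proof.
rewrite big_distrlr big_mkcond [RHS]big_mkcond big_allpairs /=.
apply: eq_bigr => x _; case: (P x); last by rewrite big1.
by rewrite big_mkcond; apply: eq_bigr => y _; case: ifP => // _; rewrite exprD.
Qed.

Definition theta P : fps R := Fps (fun n => (\sum_(x <- ints n | P x) X ^+ sqz x) n).

Lemma theta_box P N :
  eq_below N (theta P) (\sum_(x <- ints N | P x) X ^+ sqz x).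
Proof.
move=> n /ltnW le_nN; apply: (@vector_sum_bij _ _ _ _ _ _ _ _ id) => //.
- exact: ints_uniq.
- exact: ints_uniq.
- by move=> x <-; rewrite mem_ints leq_sqz.
- by move=> x xn; rewrite mem_ints; apply: leq_trans le_nN; rewrite -xn leq_sqz.
- by move=> x Px; exists x.
Qed.

Lemma subXn_sum I r (P : pred I) (F : I -> fps R) k :
  subXn k (\sum_(i <- r | P i) F i) = \sum_(i <- r | P i) subXn k (F i).
Proof.
apply: (big_morph _ (@subXnD R k)); apply: fpsP => n.
by rewrite subXnE !fps0 if_same.
Qed.

Lemma subXnXn k n : (0 < k)%N -> subXn k (X ^+ n) = X ^+ (k * n).
Proof.
move=> k0; apply: fpsP => i; rewrite subXnE !fpsXn.
case: ifP => [/dvdnP[j ->]|]; first by rewrite mulnK // mulnC eqn_pmul2l.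
by move=> ndv; case: eqP ndv => // ->; rewrite dvdn_mulr.
Qed.

Lemma subXn_box (T : Type) (s : seq T) (P : pred T) (Q : T -> nat) k : (0 < k)%N ->
  subXn k (\sum_(v <- s | P v) X ^+ Q v) = \sum_(v <- s | P v) X ^+ (k * Q v).
Proof. by move=> k0; rewrite subXn_sum; apply: eq_bigr => v _; rewrite subXnXn. Qed.

Lemma eq_below_subXn k N (f g : fps R) :
  eq_below N f g -> eq_below N (subXn k f) (subXn k g).
Proof.
move=> efg n ltnN; rewrite !subXnE; case: ifP => // _; apply: efg.
exact: leq_ltn_trans (leq_div _ _) ltnN.
Qed.

Lemma theta_subXn_box P N k : (0 < k)%N ->
  eq_below N (subXn k (theta P)) (\sum_(x <- ints N | P x) X ^+ (k * sqz x)).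
Proof.
by move=> k0 n ltnN; rewrite (@eq_below_subXn k N _ _ (@theta_box P N) n ltnN) subXn_box.
Qed.

Lemma eq_theta P P' : P =1 P' -> theta P = theta P'.
Proof. by move=> eP; apply: fpsP => n /=; congr (coef _ n); apply: eq_bigl. Qed.

Lemma theta_dvdz m : (0 < m)%N ->
  theta (fun x => (m%:Z %| x)%Z) = subXn (m ^ 2) (theta predT).
Proof.
move=> m0; apply/esym/eq_belowP => N n ltnN.
have m20 : (0 < m ^ 2)%N by rewrite expn_gt0 m0.
rewrite (theta_subXn_box _ m20 ltnN) (theta_box _ ltnN).
apply: (@vector_sum_bij _ _ _ _ _ _ _ _ (fun x => m%:Z * x)) => //.
- exact: ints_uniq.
- exact: ints_uniq.
- move=> x xn; rewrite mem_ints; apply: leq_trans (ltnW ltnN); rewrite -xn.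
  by apply: leq_trans (leq_sqz x) _; rewrite leq_pmull.
- by move=> x xn; rewrite mem_ints; apply: leq_trans (ltnW ltnN); rewrite -xn leq_sqz.
- by move=> x y; apply: mulfI; rewrite eqz_nat -lt0n.
- by move=> x; rewrite /sqz abszM expnMn.
- by move=> x _; apply: dvdz_mulr.
- by move=> x /dvdzP[y ->]; exists y; rewrite 1?mulrC.
Qed.

Lemma theta_opp P : theta (fun x => P (- x)) = theta P.
Proof.
apply: fpsP => n; apply: (@vector_sum_bij _ _ _ _ _ _ _ _ -%R) => //.
- exact: ints_uniq.
- exact: ints_uniq.
- by move=> x <-; rewrite mem_ints leq_sqz.
- by move=> x <-; rewrite mem_ints leq_sqz.
- exact: oppr_inj.
- exact: sqzN.
- by move=> x Px; exists (- x); rewrite ?opprK.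
Qed.

Lemma supported_theta m r P :
  (forall x, P x -> sqz x = r %[mod m]) -> supported m r (theta P).
Proof.
move=> Pr n nr; rewrite /theta /= fps_sum big1_seq // => x /andP[/Pr xr _].
by rewrite fpsXn; case: eqP => // nx; rewrite nx xr eqxx in nr.
Qed.

Definition theta_class p (j : 'F_p) : fps R :=
  theta (fun x => x%:~R == j).

Lemma theta_classN p (j : 'F_p) : theta_class (- j) = theta_class j.
Proof.
rewrite /theta_class -theta_opp; apply: eq_theta => x.
by rewrite rmorphN /= eqr_opp.
Qed.

Lemma theta_partition p : theta predT = \sum_(j : 'F_p) theta_class j.
Proof.
apply/eq_belowP => N n ltnN; rewrite (theta_box _ ltnN) [RHS]fps_sum.
under [RHS]eq_bigr => j _ do rewrite (theta_box _ ltnN).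
rewrite -fps_sum; congr (coef _ n).
exact: (partition_big (fun x : int => x%:~R : 'F_p) xpredT).
Qed.

Lemma theta_class0 p : prime p -> theta_class (0 : 'F_p) = subXn (p ^ 2) (theta predT).
Proof.
move=> p_pr; rewrite -theta_dvdz ?prime_gt0 //; apply: eq_theta => x.
by rewrite (dvdz_pcharf (pchar_Fp p_pr)).
Qed.
End ThetaSeries.

(** ** Two identities from isometric sublattices *)

Section LatticeIdentities.
Variable R : comNzRingType.
Local Notation X := (fpsX R).
Local Notation phi := (theta R predT).

Lemma eq_below_sum (I : Type) (r : seq I) (P : pred I) N (F G : I -> fps R) :
  (forall i, P i -> eq_below N (F i) (G i)) ->
  eq_below N (\sum_(i <- r | P i) F i) (\sum_(i <- r | P i) G i).
Proof. by move=> eFG n ltnN; rewrite !fps_sum; apply: eq_bigr => i /eFG ->. Qed.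

Lemma eq_intr_Fp p (x y : int) : prime p ->
  (x%:~R == y%:~R :> 'F_p) = (p%:Z %| x - y)%Z.
Proof.
by move=> p_pr; rewrite (dvdz_pcharf (pchar_Fp p_pr)) rmorphB subr_eq0.
Qed.

(** The map (u, v) -> (u - 2 v, 2 u + v) multiplies the norm by 5, and its image
    consists of the (x, y) with y = 2 x modulo 5; sorting these by the class j of
    x gives the right-hand side. *)
Lemma theta_q5_sqr :
  subXn 5 phi ^+ 2 = \sum_(j : 'F_5) theta_class R j * theta_class R (j *+ 2).
Proof.
apply: eq_belowP => N n ltnN; rewrite expr2.
have lhs := @theta_subXn_box R predT N 5 isT.
rewrite (eq_belowM lhs lhs ltnN) vector_sum_mul.
have rhs (j : 'F_5) := eq_belowM (@theta_box R (fun x => x%:~R == j) N)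
  (@theta_box R (fun x => x%:~R == j *+ 2) N).
rewrite [RHS](@eq_below_sum _ _ _ _ _ _ (fun j _ => rhs j) n ltnN) {lhs rhs}.
under [in RHS]eq_bigr => j _ do rewrite vector_sum_mul.
pose P (v : int * int) := v.2%:~R == (v.1 *+ 2)%:~R :> 'F_5.
transitivity ((\sum_(v <- pairs (ints N) | P v) X ^+ (sqz v.1 + sqz v.2)) n); last first.
  congr (coef _ n).
  rewrite (partition_big (fun v : int * int => v.1%:~R : 'F_5) xpredT) //=.
  apply: eq_bigr => j _; apply: eq_bigl => v; rewrite /P andbC.
  by case: eqP => //= <-; rewrite rmorphMn.
apply: (@vector_sum_bij _ _ _ _ _ _ _ _ _
  (fun u : int * int => (u.1 - 2 * u.2, 2 * u.1 + u.2))).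
- exact/pairs_uniq/ints_uniq.
- exact/pairs_uniq/ints_uniq.
- move=> [x y] /= xyn; rewrite mem_pairs !mem_ints /=.
  by have := leq_sqz x; have := leq_sqz y; lia.
- move=> [x y] /= xyn; rewrite mem_pairs !mem_ints /=.
  by have := leq_sqz x; have := leq_sqz y; lia.
- by move=> [x y] [x' y'] [] /= *; congr (_, _); lia.
- move=> [x y] /=; apply/eqP; rewrite -mulnDr -eqz_nat (PoszM 5) !(PoszD (sqz _)) !sqzE; apply/eqP; ring.
- by move=> [x y] _; rewrite /P eq_intr_Fp //; apply/dvdzP; exists y => /=; ring.
- move=> [x y]; rewrite /P eq_intr_Fp //= => /dvdzP[k yk].
  by exists (x + 2 * k, k) => //=; congr (_, _); lia.
Qed.

(** The four-dimensional analogue: the map is given by a matrix M with M M^T = 3,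
    and its image consists of the vectors whose reduction modulo 3 is in the
    tetracode, a self-dual code whose words (k - j, - j - k, j, k) are determined
    by their last two letters. *)
Lemma theta_q3_pow4 :
  subXn 3 phi ^+ 4 = \sum_(j : 'F_3) \sum_(k : 'F_3)
    (theta_class R (k - j) * theta_class R (- j - k)) *
    (theta_class R j * theta_class R k).
Proof.
apply: eq_belowP => N n ltnN.
have -> : subXn 3 phi ^+ 4 = (subXn 3 phi * subXn 3 phi) * (subXn 3 phi * subXn 3 phi).
  by ring.
have lhs := @theta_subXn_box R predT N 3 isT.
have lhs2 := eq_belowM lhs lhs.
rewrite (eq_belowM lhs2 lhs2 ltnN) !vector_sum_mul.
have box (j : 'F_3) := @theta_box R (fun x => x%:~R == j) N.
have rhs (j k : 'F_3) := eq_belowM (eq_belowM (box (k - j)) (box (- j - k)))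
  (eq_belowM (box j) (box k)).
rewrite [RHS](@eq_below_sum _ _ _ _ _ _ (fun j _ =>
  @eq_below_sum _ _ _ _ _ _ (fun k _ => rhs j k)) n ltnN) {lhs lhs2 rhs}.
under [in RHS]eq_bigr => j _ do under eq_bigr => k _ do rewrite !vector_sum_mul.
pose I2 := pairs (ints N).
have uI2 : uniq (pairs I2) by do 2!apply: pairs_uniq; apply: ints_uniq.
pose P (v : (int * int) * (int * int)) :=
  (v.1.1%:~R == (v.2.2 - v.2.1)%:~R :> 'F_3) &&
  (v.1.2%:~R == (- v.2.1 - v.2.2)%:~R :> 'F_3).
transitivity ((\sum_(v <- pairs I2 | P v)
    X ^+ (sqz v.1.1 + sqz v.1.2 + (sqz v.2.1 + sqz v.2.2))) n); last first.
  congr (coef _ n).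
  rewrite (partition_big (fun v => v.2.1%:~R : 'F_3) xpredT) //=.
  apply: eq_bigr => j _.
  rewrite (partition_big (fun v => v.2.2%:~R : 'F_3) xpredT) //=.
  apply: eq_bigr => k _; apply: eq_bigl => v; rewrite /P !rmorphB rmorphN /=.
  case: (_ =P j) => [->|_]; last by rewrite !andbF.
  by case: (_ =P k) => [->|_]; rewrite ?andbF // !andbT.
apply: (@vector_sum_bij _ _ _ _ _ _ _ _ _
  (fun u : (int * int) * (int * int) =>
    ((u.1.2 + u.2.1 + u.2.2, u.1.1 - u.2.1 + u.2.2),
     (u.1.1 + u.1.2 - u.2.2, u.1.1 - u.1.2 + u.2.1)))) => //.
- move=> [[x y] [z t]] /= xyn; rewrite !mem_pairs !mem_ints /=.
  have := (leq_sqz x, leq_sqz y, leq_sqz z, leq_sqz t).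
  by case=> [] [] []; lia.
- move=> [[x y] [z t]] /= xyn; rewrite !mem_pairs !mem_ints /=.
  have := (leq_sqz x, leq_sqz y, leq_sqz z, leq_sqz t).
  by case=> [] [] []; lia.
- by move=> [[x y] [z t]] [[x' y'] [z' t']] [] /= *; congr (_, _, (_, _)); lia.
- move=> [[x y] [z t]] /=; apply/eqP.
  rewrite -!mulnDr -eqz_nat (PoszM 3) !(PoszD (sqz _ + sqz _)) !(PoszD (sqz _)) !sqzE.
  by apply/eqP; ring.
- move=> [[x y] [z t]] _; rewrite /P !eq_intr_Fp //=.
  by apply/andP; split; apply/dvdzP; [exists y|exists x]; ring.
- move=> [[x y] [z t]]; rewrite /P !eq_intr_Fp //=.
  case/andP=> /dvdzP[l el] /dvdzP[k ek].
  by exists ((k, l), (l - k + t, l + k - z)) => //=; congr (_, _, (_, _)); lia.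
Qed.
End LatticeIdentities.

Lemma big_Fp3 (V : zmodType) (F : 'F_3 -> V) :
  \sum_(j : 'F_3) F j = F 0 + F 1 + F (- 1).
Proof.
rewrite !big_ord_recl big_ord0 addr0 addrA /=.
by congr (F _ + F _ + F _); apply/eqP.
Qed.

Lemma big_Fp5 (V : zmodType) (F : 'F_5 -> V) :
  \sum_(j : 'F_5) F j = F 0 + F 1 + F 2%:R + F (- 2%:R) + F (- 1).
Proof.
rewrite !big_ord_recl big_ord0 addr0 !addrA /=.
by congr (F _ + F _ + F _ + F _ + F _); apply/eqP.
Qed.

(** * Trisection of the theta function and of its reciprocal *)

Section Theta3.
Variable R : comNzRingType.
Local Notation phi := (theta R predT).

Definition phi3 : fps R := subXn 3 phi.
Definition phi9 : fps R := subXn 9 phi.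
(** phi1 collects the q^(x^2) with x prime to 3, whose exponents are all equal to 1
    modulo 3. *)
Definition phi1 : fps R := phi - phi9.

Lemma phi_0 : phi 0%N = 1.
Proof. by rewrite /theta /= big_cons big_nil /= addr0. Qed.

Lemma phi3_0 : phi3 0%N = 1. Proof. exact: phi_0. Qed.

Lemma phi9_0 : phi9 0%N = 1. Proof. exact: phi_0. Qed.

Lemma phi_split3 : phi = phi9 + phi1.
Proof. by rewrite /phi1; ring. Qed.

Lemma phi9E : phi9 = subXn 3 phi3.
Proof. by rewrite /phi3 subXn_subXn. Qed.

Lemma phi1E : phi1 = theta_class R (1 : 'F_3) *+ 2.
Proof.
rewrite /phi1 (theta_partition R 3) big_Fp3 theta_classN theta_class0 // /phi9.
by ring.
Qed.

Lemma supported_phi1 : supported 3 1 phi1.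
Proof.
rewrite phi1E mulr2n.
have s1 : supported 3 1 (theta_class R (1 : 'F_3)).
  apply: supported_theta => x; rewrite -(rmorph1 intr) eq_intr_Fp //.
  move=> /dvdzP[k xk]; have := sqzE x; have -> : x = k * 3 + 1 by lia.
  rewrite /sqz; lia.
exact: supportedD.
Qed.

Lemma supported_monomial i j r : (j = r %[mod 3])%N ->
  supported 3 r (phi9 ^+ i * phi1 ^+ j).
Proof.
move=> jr; apply: (@supported_eqmod _ _ (0 * i + 1 * j)); first by rewrite mul0n mul1n.
apply: supportedM; apply: supportedX; last exact: supported_phi1.
by rewrite phi9E; apply: supported_subXn.
Qed.

(** Each of the 8 nonzero words of the tetracode has exactly one zero letter, so
    it contributes phi9 times the cube of phi1 / 2. *)
Lemma phi_cubic : phi3 ^+ 4 = phi9 ^+ 4 + phi9 * phi1 ^+ 3.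
Proof.
rewrite /phi3 theta_q3_pow4 !big_Fp3 phi1E.
have th0 : theta_class R (0 : 'F_3) = phi9 by exact: theta_class0.
have m11 : - 1 - 1 = 1 :> 'F_3 by apply/eqP.
rewrite !(addr0, subr0, sub0r, oppr0, opprK, subrr, m11, addNr) -?opprD.
have p11 : 1 + 1 = - 1 :> 'F_3 by apply/eqP.
rewrite !(p11, opprK) !theta_classN th0.
by ring.
Qed.
End Theta3.

(** Algebra with large exponents is stated over an abstract ring, whose
    operations do not reduce. *)
Lemma recip_cancel9 (A : comNzRingType) (x y c : A) : x * y = 1 ->
  x ^+ 3 * ((c ^+ 12 *+ 27 - c ^+ 8 * x ^+ 4 *+ 36 + c ^+ 4 * x ^+ 8 *+ 10) * y ^+ 16) =
  c ^+ 12 * y ^+ 13 *+ 27 - c ^+ 8 * y ^+ 9 *+ 36 + c ^+ 4 * y ^+ 5 *+ 10.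
Proof.
move=> xy1; have e k : x ^+ k * y ^+ k = 1 by rewrite -exprMn xy1 expr1n.
transitivity ((c ^+ 12 * y ^+ 13 * (x ^+ 3 * y ^+ 3)) *+ 27
  - c ^+ 8 * y ^+ 9 * (x ^+ 7 * y ^+ 7) *+ 36
  + c ^+ 4 * y ^+ 5 * (x ^+ 11 * y ^+ 11) *+ 10); first by ring.
by rewrite !e !mulr1.
Qed.

Lemma every3_split (R : comNzRingType) (f g f1 f2 : fps R) :
  supported 3 1 f1 -> supported 3 2 f2 -> f = subXn 3 g + f1 + f2 -> every 3 f = g.
Proof.
move=> s1 s2 ->; rewrite !everyD every_subXn //.
by rewrite (every_supported _ s1) // (every_supported _ s2) // !addr0.
Qed.

Lemma subXn_lin3 (R : comNzRingType) m (f g h : fps R) i j k :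
  subXn m (f *+ i - g *+ j + h *+ k) = subXn m f *+ i - subXn m g *+ j + subXn m h *+ k.
Proof. by rewrite !(subXnD, subXnN, subXnMn). Qed.

(** Closes a goal supported 3 r f when f is a combination of products
    phi9^i phi1^j with j = r modulo 3. *)
Ltac monomials := by do ?[apply: supportedD | apply: supportedN | apply: supportedMn
                         | apply: supported_monomial].

Section Reciprocal.
Variables (R : comNzRingType) (B : fps R).
Local Notation phi := (theta R predT).
Local Notation phi1 := (phi1 R).
Local Notation phi3 := (phi3 R).
Local Notation phi9 := (phi9 R).
Hypothesis phiB : phi * B = 1.

Lemma phi_cancel k (f g : fps R) : phi ^+ k * f = g -> f = g * B ^+ k.
Proof. by move=> <-; rewrite mulrAC -exprMn phiB expr1n mul1r. Qed.

(** The cubic relation says that phi3^4 = phi9 (phi9^3 + phi1^3), and the factor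
    phi9 + phi1 is phi itself. *)
Lemma phi3_4_recip :
  phi3 ^+ 4 * B = phi9 * (phi9 ^+ 2 - phi9 * phi1 + phi1 ^+ 2).
Proof.
apply/esym/(phi_cancel (k := 1)); rewrite expr1 phi_cubic [in LHS]phi_split3.
by ring.
Qed.

Lemma every3_recip : every 3 B = phi3 ^+ 3 * B ^+ 4.
Proof.
apply: phi_cancel; rewrite -every_subXnM // subXnX // -/phi3 phi3_4_recip.
apply: (@every3_split _ _ _ (- (phi9 ^+ 2 * phi1 ^+ 1)) (phi9 ^+ 1 * phi1 ^+ 2)).
- monomials.
- monomials.
- by rewrite subXnX // -phi9E; ring.
Qed.

(** As phi3^16 B^4 is the fourth power of a quadratic form in phi9 and phi1, its
    multisection only keeps the monomials with exponent of phi1 divisible by 3,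
    and phi_cubic eliminates phi1 from these. *)
Lemma every9_recip :
  every 3 (every 3 B) =
    phi3 ^+ 12 * B ^+ 13 *+ 27 - phi3 ^+ 8 * B ^+ 9 *+ 36 + phi3 ^+ 4 * B ^+ 5 *+ 10.
Proof.
rewrite every3_recip -subXnX // every_subXnM //.
have -> : every 3 (B ^+ 4) =
    (phi3 ^+ 12 *+ 27 - phi3 ^+ 8 * phi ^+ 4 *+ 36 + phi3 ^+ 4 * phi ^+ 8 *+ 10) * B ^+ 16.
  apply: phi_cancel; rewrite -every_subXnM // subXnX // -/phi3.
  have -> : phi3 ^+ 16 * B ^+ 4 = (phi3 ^+ 4 * B) ^+ 4 by ring.
  rewrite phi3_4_recip.
  apply: (@every3_split _ _ _
    (- (phi9 ^+ 11 * phi1 ^+ 1 *+ 4) + phi9 ^+ 8 * phi1 ^+ 4 *+ 19 - phi9 ^+ 5 * phi1 ^+ 7 *+ 4)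
    (phi9 ^+ 10 * phi1 ^+ 2 *+ 10 - phi9 ^+ 7 * phi1 ^+ 5 *+ 16 + phi9 ^+ 4 * phi1 ^+ 8)).
  - monomials.
  - monomials.
  have subE i j : subXn 3 (phi3 ^+ i * phi ^+ j) = phi9 ^+ i * phi3 ^+ j.
    by rewrite subXnM // !subXnX // -phi9E.
  rewrite subXn_lin3 !subE subXnX // -phi9E.
  have -> : phi3 ^+ 8 = (phi3 ^+ 4) ^+ 2 by ring.
  by rewrite phi_cubic; ring.
exact: recip_cancel9.
Qed.
End Reciprocal.

(** * The theta function and its reciprocal modulo 5 *)

(** Identities modulo 5 are proved over the integers; e is the quotient by 5 of
    the difference of the two sides. *)
Lemma mod5P (A : comNzRingType) (x y e : A) : 5%:R = 0 :> A -> x = y + 5%:R * e -> x = y.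
Proof. by move=> -> ->; rewrite mul0r addr0. Qed.

Section Mod5.
Local Notation series := (fps 'F_5).
Implicit Types f g : series.
Local Notation phi := (theta 'F_5 predT).
Local Notation phi1 := (phi1 'F_5).
Local Notation phi3 := (phi3 'F_5).
Local Notation phi9 := (phi9 'F_5).

Lemma five0 : 5%:R = 0 :> 'F_5. Proof. exact/eqP. Qed.

Lemma fps5 : 5%:R = 0 :> series.
Proof.
by apply: fpsP => n; rewrite fpsMn fps1 fps0; case: eqP => _; rewrite ?five0 ?mul0rn.
Qed.

Lemma fps_pow5 f : f ^+ 5 = subXn 5 f.
Proof.
rewrite -[LHS]mulr1n -[RHS]mulr1n; apply: fps_frobenius => // [|n].
  by rewrite mul1n five0.
by apply/eqP; case: (f n) => [[|[|[|[|[|]]]]]].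
Qed.

Lemma exprD5 f g : (f + g) ^+ 5 = f ^+ 5 + g ^+ 5.
Proof. by rewrite !fps_pow5 subXnD. Qed.

Lemma phi_pow25 : subXn 25 phi = phi ^+ 25.
Proof. by rewrite (exprM phi 5 5) !fps_pow5 subXn_subXn. Qed.

Local Notation t1 := (theta_class 'F_5 (1 : 'F_5)).
Local Notation t2 := (theta_class 'F_5 (2%:R : 'F_5)).

Lemma phi_split5 : phi = phi ^+ 25 + t1 *+ 2 + t2 *+ 2.
Proof.
rewrite [LHS](theta_partition _ 5) big_Fp5 !theta_classN theta_class0 //.
rewrite phi_pow25. by ring.
Qed.

Lemma phi_pow10 : phi ^+ 10 = (phi ^+ 25) ^+ 2 + t1 * t2 *+ 4.
Proof.
rewrite (exprM phi 5 2) fps_pow5 theta_q5_sqr big_Fp5 mul0rn theta_class0 // phi_pow25.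
have e2 : 2%:R *+ 2 = - 1 :> 'F_5 by apply/eqP.
by rewrite !mulNrn e2 opprK !theta_classN; ring.
Qed.

Lemma qderiv_t1 : qderiv t1 = t1.
Proof.
rewrite (@qderiv_supported _ 5 1) ?five0 //; apply: supported_theta => x.
rewrite -(rmorph1 intr) eq_intr_Fp // => /dvdzP[k xk]; have := sqzE x.
have -> : x = k * 5 + 1 by lia.
rewrite /sqz; lia.
Qed.

Lemma qderiv_t2 : qderiv t2 = t2 *+ 4.
Proof.
rewrite (@qderiv_supported _ 5 4) ?five0 //; apply: supported_theta => x.
rewrite -(rmorph_nat intr) eq_intr_Fp // => /dvdzP[k xk]; have := sqzE x.
have -> : x = k * 5 + 2 by lia.
rewrite /sqz; lia.
Qed.

Lemma qderiv_phi : qderiv phi = t1 *+ 2 + t2 *+ 8.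
Proof.
rewrite {1}phi_split5 -phi_pow25 !mulr2n !qderivD qderiv_t1 qderiv_t2.
rewrite (@qderiv_supported _ 5 0 _ five0) ?mulr0n; first by ring.
by rewrite -[25%N]/(5 * 5)%N -subXn_subXn //; apply: supported_subXn.
Qed.

(** This reflects x^4 = 1 modulo 5 for x prime to 5. *)
Lemma qderiv2_phi : qderiv (qderiv phi) = phi - phi ^+ 25.
Proof.
rewrite qderiv_phi [X in _ = X - _]phi_split5.
have -> : t1 *+ 2 + t2 *+ 8 = t1 + t1 + (t2 + t2 + t2) by
  apply: (mod5P (e := t2) fps5); ring.
rewrite !qderivD qderiv_t1 qderiv_t2.
by apply: (mod5P (e := t2 *+ 2) fps5); ring.
Qed.

(** With phi = F + 2 t1 + 2 t2 and F = phi^25, the derivative of phi is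
    2 t1 - 2 t2 modulo 5.  Its square is (phi - F)^2 - 16 t1 t2, and phi_pow10
    expresses the product t1 t2 through phi. *)
Lemma qderiv_phi_sq : qderiv phi ^+ 2 = phi ^+ 2 + phi ^+ 10 - phi ^+ 26 *+ 2.
Proof.
rewrite qderiv_phi (exprS phi 25) phi_pow10.
have := phi_split5; move: (phi ^+ 25) => F ->.
by apply: (mod5P (e := t1 * t2 *+ 4 + t2 ^+ 2 *+ 12) fps5); ring.
Qed.

(** These are the components of qderiv_phi_sq in the three classes modulo 3. *)
Lemma qderiv_split3 :
  [/\ qderiv phi9 ^+ 2 = phi9 ^+ 2 + phi9 ^+ 10 - phi9 ^+ 26 *+ 2,
      qderiv phi9 * qderiv phi1 *+ 2 =
        phi9 * phi1 *+ 2 + phi1 ^+ 10 - phi9 ^+ 25 * phi1 *+ 2 - phi9 * phi1 ^+ 25 *+ 2 &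
      qderiv phi1 ^+ 2 =
        phi1 ^+ 2 + phi9 ^+ 5 * phi1 ^+ 5 *+ 2 - phi1 ^+ 26 *+ 2].
Proof.
have s9 : supported 3 0 (qderiv phi9).
  by apply: supported_qderiv; rewrite phi9E; apply: supported_subXn.
have s1 : supported 3 1 (qderiv phi1) by apply/supported_qderiv/supported_phi1.
have mono i j r := @supported_monomial 'F_5 i j r.
apply: supported3_inj.
- exact: (supportedX (k := 2) s9).
- exact/supportedMn/(supportedM s9 s1).
- exact: (supportedX (k := 2) s1).
- have -> : phi9 ^+ 2 + phi9 ^+ 10 - phi9 ^+ 26 *+ 2 =
    phi9 ^+ 2 * phi1 ^+ 0 + phi9 ^+ 10 * phi1 ^+ 0 - phi9 ^+ 26 * phi1 ^+ 0 *+ 2 by ring.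
  by do ?[apply: supportedD|apply: supportedN|apply: supportedMn|apply: mono].
- have -> : phi9 * phi1 *+ 2 + phi1 ^+ 10 - phi9 ^+ 25 * phi1 *+ 2 - phi9 * phi1 ^+ 25 *+ 2
    = phi9 ^+ 1 * phi1 ^+ 1 *+ 2 + phi9 ^+ 0 * phi1 ^+ 10 - phi9 ^+ 25 * phi1 ^+ 1 *+ 2
      - phi9 ^+ 1 * phi1 ^+ 25 *+ 2 by ring.
  by do ?[apply: supportedD|apply: supportedN|apply: supportedMn|apply: mono].
- have -> : phi1 ^+ 2 + phi9 ^+ 5 * phi1 ^+ 5 *+ 2 - phi1 ^+ 26 *+ 2 =
    phi9 ^+ 0 * phi1 ^+ 2 + phi9 ^+ 5 * phi1 ^+ 5 *+ 2 - phi9 ^+ 0 * phi1 ^+ 26 *+ 2 by ring.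
  by do ?[apply: supportedD|apply: supportedN|apply: supportedMn|apply: mono].
transitivity (qderiv phi ^+ 2); first by rewrite phi_split3 qderivD; ring.
rewrite qderiv_phi_sq (exprM phi 5 2) (exprSr phi 25) (exprM phi 5 5).
have -> : phi ^+ 5 = phi9 ^+ 5 + phi1 ^+ 5 by rewrite [in LHS]phi_split3 exprD5.
by rewrite (exprD5 (phi9 ^+ 5)) phi_split3; ring.
Qed.

Lemma qderivMn f k : qderiv (f *+ k) = qderiv f *+ k.
Proof. by apply: fpsP => n; rewrite !(qderivE, fpsMn) mulrnAr. Qed.

Lemma subXnB m f g : subXn m (f - g) = subXn m f - subXn m g.
Proof. by rewrite subXnD subXnN. Qed.

Lemma qderiv2_subXn m : (0 < m)%N ->
  qderiv (qderiv (subXn m phi)) = (subXn m phi - subXn m phi ^+ 25) *+ (m ^ 2).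
Proof.
move=> m0; rewrite qderiv_subXn // qderivMn qderiv_subXn // qderiv2_phi.
by rewrite subXnB subXnX // -mulrnA.
Qed.

Lemma qderiv2_phi1 : qderiv (qderiv phi1) = phi1 - phi1 ^+ 25.
Proof.
have := qderiv2_phi; rewrite (exprM phi 5 5) [in RHS]phi_split3 exprD5 (exprD5 (phi9 ^+ 5)).
rewrite {1}phi_split3 !qderivD [qderiv (qderiv phi9)]qderiv2_subXn // -/phi9.
move=> e; apply: (@addrI _ ((phi9 - phi9 ^+ 25) *+ 81)); rewrite e.
by apply: (mod5P (e := - (phi9 - phi9 ^+ 25) *+ 16) fps5); ring.
Qed.

Lemma qderiv_phi3_sq :
  qderiv phi3 ^+ 2 = (phi3 ^+ 2 + phi3 ^+ 10 - phi3 ^+ 26 *+ 2) *+ 9.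
Proof.
rewrite qderiv_subXn // exprMn_n -subXnX // qderiv_phi_sq.
by rewrite !(subXnD, subXnN, subXnMn) !subXnX.
Qed.

Lemma qderiv2_pow4 f :
  qderiv (qderiv (f ^+ 4)) =
    f ^+ 3 * qderiv (qderiv f) *+ 4 + f ^+ 2 * qderiv f ^+ 2 *+ 12.
Proof. by rewrite (_ : f ^+ 4 = f * f * f * f) ?(qderivM, qderivD); ring. Qed.

Lemma qderiv2_mul_cube f g :
  qderiv (qderiv (f * g ^+ 3)) =
    qderiv (qderiv f) * g ^+ 3 + g ^+ 2 * (qderiv f * qderiv g *+ 2) *+ 3
    + f * (g ^+ 2 * qderiv (qderiv g) *+ 3 + g * qderiv g ^+ 2 *+ 6).
Proof. by rewrite (_ : g ^+ 3 = g * g * g) ?(qderivM, qderivD); ring. Qed.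

Local Notation C := (phi3 ^+ 4).
Local Notation G := (phi9 ^+ 4).

(** Differentiating phi_cubic twice gives, by qderiv_split3, a polynomial relation
    between C and G once V = phi9 phi1^3 is replaced by C - G.  It has degree 9,
    and the multiplier phi9^8 makes it polynomial in C, G and V. *)
Lemma theta_level3_mod5 :
  (C ^+ 2 + G ^+ 2) * (C ^+ 2 - C * G *+ 2 - G ^+ 2) = C * G.
Proof.
have [sq9 sq91 sq1] := qderiv_split3.
have := congr1 (fun f => qderiv (qderiv f)) (phi_cubic 'F_5).
rewrite qderivD qderivD !qderiv2_pow4 qderiv2_mul_cube sq9 sq91 sq1.
rewrite qderiv_phi3_sq qderiv2_phi1 qderiv2_subXn // [qderiv (qderiv phi9)]qderiv2_subXn //.
rewrite -/phi3 -/phi9 => /eqP; rewrite -subr_eq0.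
move=> /eqP/(congr1 (fun f => phi9 ^+ 8 * f)); rewrite mulr0 => ode.
have {}ode : let V := phi9 * phi1 ^+ 3 in
    G ^+ 2 * (C *+ 144 + C ^+ 3 *+ 108 - C ^+ 7 *+ 252
              - G *+ 336 - G ^+ 3 *+ 12 + G ^+ 7 *+ 348 - V *+ 96)
    + G ^+ 8 * V *+ 87 - G * V ^+ 4 *+ 3 + V ^+ 9 *+ 21 - G ^+ 3 * V ^+ 2 *+ 12 = 0.
  by rewrite /= -[RHS]ode; ring.
have cubic : phi9 * phi1 ^+ 3 = C - G by rewrite phi_cubic; ring.
have C0 : C 0%N = 1 by rewrite fps_exp0 phi3_0 expr1n.
have G0 : G 0%N = 1 by rewrite fps_exp0 phi9_0 expr1n.
move: ode; rewrite /= cubic; move: (C) (G) C0 G0 => c g c0 g0 ode.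
apply/eqP; rewrite -subr_eq0; apply/eqP.
(* The cofactor Q comes from polynomial division modulo 5 and is normalized so
   that its constant term is 6 = 1. *)
pose Q := c ^+ 5 *+ 4 + c ^+ 4 * g *+ 2 + c ^+ 2 * g ^+ 3 *+ 2 + c ^+ 2 * g *+ 4
          - c * g ^+ 4 *+ 4 - g *+ 2.
apply: (@fps_mul_eq0 _ Q).
  rewrite /Q !(fpsD, fpsN, fpsMn, fps_mul0, fps_exp0) c0 g0.
  exact/eqP.
rewrite -[RHS]oppr0 -ode.
apply: (mod5P (e := c ^+ 9 *+ 5 - c ^+ 8 * g *+ 39 + c ^+ 7 * g ^+ 2 *+ 100
  - c ^+ 6 * g ^+ 3 *+ 354 + c ^+ 5 * g ^+ 4 *+ 526 - c ^+ 5 * g ^+ 2 *+ 2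
  - c ^+ 4 * g ^+ 5 *+ 528 - c ^+ 4 * g + c ^+ 3 * g ^+ 6 *+ 352
  - c ^+ 3 * g ^+ 4 *+ 2 + c ^+ 3 * g ^+ 2 *+ 24 - c ^+ 2 * g ^+ 7 *+ 150
  - c ^+ 2 * g ^+ 3 *+ 6 + c * g ^+ 8 *+ 56 + c * g ^+ 4 *+ 8 + c * g ^+ 2 *+ 10
  + g ^+ 9 *+ 48 - g ^+ 5 *+ 5 - g ^+ 3 *+ 48) fps5).
by rewrite /Q; ring.
Qed.
End Mod5.

Lemma recip_cancel9_mod5 (A : comNzRingType) (x y c : A) :
  5%:R = 0 :> A -> x * y = 1 ->
  c ^+ 60 * (c ^+ 12 * y ^+ 13 *+ 27 - c ^+ 8 * y ^+ 9 *+ 36 + c ^+ 4 * y ^+ 5 *+ 10) =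
  c ^+ 12 * (x ^+ 2 * ((c ^+ 4 * y) ^+ 5) ^+ 3) *+ 2 - c ^+ 28 * (x * ((c ^+ 4 * y) ^+ 5) ^+ 2).
Proof.
move=> A5 xy1; have e k : x ^+ k * y ^+ k = 1 by rewrite -exprMn xy1 expr1n.
transitivity (c ^+ 60 * (c ^+ 12 * y ^+ 13 * (x ^+ 2 * y ^+ 2) *+ 2
  - c ^+ 8 * y ^+ 9 * (x ^+ 1 * y ^+ 1))); last by rewrite expr1; ring.
rewrite !e !mulr1.
apply: (mod5P (e := c ^+ 72 * y ^+ 13 *+ 5 - c ^+ 68 * y ^+ 9 *+ 7
                    + c ^+ 64 * y ^+ 5 *+ 2) A5).
by ring.
Qed.

(** The squares modulo 5 are 0, 1 and 4. *)
Definition square_supported (R : comNzRingType) (f : fps R) :=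
  forall n, (n %% 5 == 2)%N || (n %% 5 == 3)%N -> f n = 0.

Lemma square_supportedD (R : comNzRingType) (f g : fps R) :
  square_supported f -> square_supported g -> square_supported (f + g).
Proof. by move=> sf sg n n5; rewrite fpsD sf // sg // addr0. Qed.

Lemma square_supportedN (R : comNzRingType) (f : fps R) :
  square_supported f -> square_supported (- f).
Proof. by move=> sf n n5; rewrite fpsN sf // oppr0. Qed.

Lemma square_supported_theta (R : comNzRingType) P : square_supported (theta R P).
Proof.
move=> n n5; rewrite /theta /= fps_sum big1_seq // => x _.
rewrite fpsXn; case: eqP => // nx; move: n5; rewrite nx /sqz.
move: `|x|%N => k; rewrite -modnXm.
by have := ltn_pmod k (isT : (0 < 5)%N); case: (k %% 5)%N => [|[|[|[|[|]]]]].
Qed.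

(** A fifth power is a series in q^5, so it does not move exponents modulo 5. *)
Lemma square_supported_pow5 (f g : fps 'F_5) :
  square_supported g -> square_supported (f ^+ 5 * g).
Proof.
move=> sg n n5; rewrite fps_pow5 fpsM big1 // => i _; rewrite subXnE.
case: ifP => [/dvdnP[k ik]|_]; last by rewrite mul0r.
by rewrite sg ?mulr0 // ik; move: n5; have := ltn_ord i; rewrite ik; lia.
Qed.

Lemma recip_cancel_split (A : comNzRingType) (x y h e0 p e2 : A) :
  x * y = 1 -> x ^+ 60 * h = e0 + - x ^+ 20 * p + e2 ->
  h = y ^+ 60 * e0 + - (y ^+ 40 * p) + y ^+ 60 * e2.
Proof.
move=> xy1 e; have xyk k : x ^+ k * y ^+ k = 1 by rewrite -exprMn xy1 expr1n.
transitivity (y ^+ 60 * (x ^+ 60 * h)); first by rewrite mulrCA mulrA xyk mul1r.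
rewrite e; transitivity (y ^+ 60 * e0 + - (y ^+ 40 * p * (x ^+ 20 * y ^+ 20)) + y ^+ 60 * e2).
  by ring.
by rewrite xyk mulr1.
Qed.

(** This form shows that the exponents are squares modulo 5 when those of a and z
    are. *)
Lemma pow5_factor (A : comNzRingType) (y a z : A) :
  y ^+ 40 * (a ^+ 30 * z *+ 2 + a ^+ 15 * z ^+ 16 + a ^+ 21 * z ^+ 10) =
  (y ^+ 8 * a ^+ 6) ^+ 5 * z + (y ^+ 8 * a ^+ 6) ^+ 5 * z
  + (y ^+ 8 * a ^+ 3 * z ^+ 3) ^+ 5 * z + (y ^+ 8 * a ^+ 4 * z ^+ 2) ^+ 5 * a.
Proof. by ring. Qed.

(** The expansion of phi^2 w^3 and phi w^2 with phi = a + z, sorted by the exponent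
    of z modulo 3; p stands for the simplified form of the class 1. *)
Lemma class_expansion (A : comNzRingType) (c a z f w p : A) :
  f = a + z -> w = a ^+ 5 * (a ^+ 10 - a ^+ 5 * z ^+ 5 + z ^+ 10) ->
  (c ^+ 12 * (a ^+ 46 * z ^+ 1 *+ 2 - a ^+ 31 * z ^+ 16 *+ 14
     + a ^+ 16 * z ^+ 31 *+ 2 + a ^+ 37 * z ^+ 10 *+ 6
     - a ^+ 22 * z ^+ 25 *+ 3 - a ^+ 40 * z ^+ 7 *+ 3
     + a ^+ 25 * z ^+ 22 *+ 6) *+ 2
   - c ^+ 28 * (a ^+ 30 * z ^+ 1 - a ^+ 15 * z ^+ 16 *+ 2
                   + a ^+ 21 * z ^+ 10 *+ 3)) = p ->
  c ^+ 12 * (f ^+ 2 * w ^+ 3) *+ 2 - c ^+ 28 * (f * w ^+ 2) =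
  (c ^+ 12 * (a ^+ 47 * z ^+ 0 - a ^+ 32 * z ^+ 15 *+ 7
    + a ^+ 17 * z ^+ 30 - a ^+ 41 * z ^+ 6 *+ 6 + a ^+ 26 * z ^+ 21 *+ 12
    + a ^+ 35 * z ^+ 12 *+ 6 - a ^+ 20 * z ^+ 27 *+ 3) *+ 2
  - c ^+ 28 * (a ^+ 31 * z ^+ 0 - a ^+ 16 * z ^+ 15 *+ 2
    - a ^+ 25 * z ^+ 6 *+ 2 + a ^+ 10 * z ^+ 21))
  + p +
  (c ^+ 12 * (a ^+ 27 * z ^+ 20 *+ 6 - a ^+ 42 * z ^+ 5 *+ 3
    + a ^+ 36 * z ^+ 11 *+ 12 - a ^+ 21 * z ^+ 26 *+ 6 + a ^+ 45 * z ^+ 2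
    - a ^+ 30 * z ^+ 17 *+ 7 + a ^+ 15 * z ^+ 32) *+ 2
  - c ^+ 28 * (a ^+ 11 * z ^+ 20 - a ^+ 26 * z ^+ 5 *+ 2
    + a ^+ 20 * z ^+ 11 *+ 3)).
Proof. by move=> -> -> <-; ring. Qed.

Section RecipMod5.
Variable B : fps 'F_5.
Local Notation phi := (theta 'F_5 predT).
Local Notation phi1 := (phi1 'F_5).
Local Notation phi3 := (phi3 'F_5).
Local Notation phi9 := (phi9 'F_5).
Local Notation C := (phi3 ^+ 4).
Local Notation G := (phi9 ^+ 4).
Hypothesis phiB : phi * B = 1.

Lemma every9_recip_mod5 :
  phi3 ^+ 60 * every 3 (every 3 B) =
    phi3 ^+ 12 * (phi ^+ 2 * ((C * B) ^+ 5) ^+ 3) *+ 2 - phi3 ^+ 28 * (phi * ((C * B) ^+ 5) ^+ 2).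
Proof.
rewrite every9_recip //; exact: recip_cancel9_mod5 fps5 phiB.
Qed.

Lemma recip_pow5 :
  (C * B) ^+ 5 = phi9 ^+ 5 * (phi9 ^+ 10 - phi9 ^+ 5 * phi1 ^+ 5 + phi1 ^+ 10).
Proof.
rewrite phi3_4_recip // exprMn exprD5 exprD5.
by ring.
Qed.

(** The left-hand side is the part of phi3^60 times the series of every9_recip
    that has exponents equal to 1 modulo 3.  After factoring out phi9^6 phi1, both
    sides are polynomials in C and G, of degrees 13 and 11; their difference is a
    multiple of the relation theta_level3_mod5, which links degrees 4 and 2. *)
Lemma every9_recip_class1 :
  (phi3 ^+ 12 * (phi9 ^+ 46 * phi1 ^+ 1 *+ 2 - phi9 ^+ 31 * phi1 ^+ 16 *+ 14
     + phi9 ^+ 16 * phi1 ^+ 31 *+ 2 + phi9 ^+ 37 * phi1 ^+ 10 *+ 6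
     - phi9 ^+ 22 * phi1 ^+ 25 *+ 3 - phi9 ^+ 40 * phi1 ^+ 7 *+ 3
     + phi9 ^+ 25 * phi1 ^+ 22 *+ 6) *+ 2
   - phi3 ^+ 28 * (phi9 ^+ 30 * phi1 ^+ 1 - phi9 ^+ 15 * phi1 ^+ 16 *+ 2
                   + phi9 ^+ 21 * phi1 ^+ 10 *+ 3))
  = - phi3 ^+ 20 * (phi9 ^+ 30 * phi1 *+ 2 + phi9 ^+ 15 * phi1 ^+ 16
                    + phi9 ^+ 21 * phi1 ^+ 10).
Proof.
apply/eqP; rewrite -subr_eq0; apply/eqP.
have cubic : phi9 * phi1 ^+ 3 = C - G by rewrite phi_cubic; ring.
pose V := phi9 * phi1 ^+ 3.
transitivity (phi9 ^+ 6 * phi1 * ((C ^+ 3 * (G ^+ 10 *+ 2 - G ^+ 5 * V ^+ 5 *+ 14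
  + V ^+ 10 *+ 2 + G ^+ 7 * V ^+ 3 *+ 6 - G ^+ 2 * V ^+ 8 *+ 3 - G ^+ 8 * V ^+ 2 *+ 3
  + G ^+ 3 * V ^+ 7 *+ 6) *+ 2
  - C ^+ 7 * (G ^+ 6 - G * V ^+ 5 *+ 2 + G ^+ 3 * V ^+ 3 *+ 3))
  + C ^+ 5 * (G ^+ 6 *+ 2 + G * V ^+ 5 + G ^+ 3 * V ^+ 3))); first by rewrite /V; ring.
rewrite /V cubic {V cubic}.
have lev := theta_level3_mod5; move: (C) (G) lev => c g lev.
rewrite [X in _ * X](_ : _ = 0) ?mulr0 //.
apply: (mod5P (e := c ^+ 13 - c ^+ 12 * g *+ 9 + c ^+ 11 * g ^+ 2 *+ 37
  - c ^+ 10 * g ^+ 3 *+ 88 + c ^+ 9 * g ^+ 4 *+ 124 - c ^+ 8 * g ^+ 5 *+ 96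
  + c ^+ 7 * g ^+ 6 *+ 31 + c ^+ 6 * g ^+ 7 - c ^+ 5 * g ^+ 8 *+ 2) fps5).
have lev0 : (c ^+ 2 + g ^+ 2) * (c ^+ 2 - c * g *+ 2 - g ^+ 2) - c * g = 0.
  by rewrite lev subrr.
rewrite -[X in _ = X + _](mulr0
  (- c ^+ 4 * (g ^+ 5 *+ 2 + (c - g) ^+ 5 + g ^+ 2 * (c - g) ^+ 3))) -lev0.
by ring.
Qed.
Lemma every9_recip_split : exists E0 E2 : fps 'F_5,
  [/\ supported 3 0 E0, supported 3 2 E2 &
      phi3 ^+ 60 * every 3 (every 3 B) =
      E0 + - phi3 ^+ 20 * (phi9 ^+ 30 * phi1 *+ 2 + phi9 ^+ 15 * phi1 ^+ 16
                           + phi9 ^+ 21 * phi1 ^+ 10) + E2].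
Proof.
have s3 k : supported 3 0 (phi3 ^+ k).
  have s0 : supported 3 0 phi3 by apply: supported_subXn.
  by have := supportedX (k := k) s0; rewrite mul0n.
exists (phi3 ^+ 12 * (phi9 ^+ 47 * phi1 ^+ 0 - phi9 ^+ 32 * phi1 ^+ 15 *+ 7
    + phi9 ^+ 17 * phi1 ^+ 30 - phi9 ^+ 41 * phi1 ^+ 6 *+ 6 + phi9 ^+ 26 * phi1 ^+ 21 *+ 12
    + phi9 ^+ 35 * phi1 ^+ 12 *+ 6 - phi9 ^+ 20 * phi1 ^+ 27 *+ 3) *+ 2
  - phi3 ^+ 28 * (phi9 ^+ 31 * phi1 ^+ 0 - phi9 ^+ 16 * phi1 ^+ 15 *+ 2
    - phi9 ^+ 25 * phi1 ^+ 6 *+ 2 + phi9 ^+ 10 * phi1 ^+ 21)).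
exists (phi3 ^+ 12 * (phi9 ^+ 27 * phi1 ^+ 20 *+ 6 - phi9 ^+ 42 * phi1 ^+ 5 *+ 3
    + phi9 ^+ 36 * phi1 ^+ 11 *+ 12 - phi9 ^+ 21 * phi1 ^+ 26 *+ 6 + phi9 ^+ 45 * phi1 ^+ 2
    - phi9 ^+ 30 * phi1 ^+ 17 *+ 7 + phi9 ^+ 15 * phi1 ^+ 32) *+ 2
  - phi3 ^+ 28 * (phi9 ^+ 11 * phi1 ^+ 20 - phi9 ^+ 26 * phi1 ^+ 5 *+ 2
    + phi9 ^+ 20 * phi1 ^+ 11 *+ 3)).
split.
- apply: supportedD; last apply: supportedN; last by apply: (supportedM (s3 _)); monomials.
  by apply: supportedMn; apply: (supportedM (s3 _)); monomials.
- apply: supportedD; last apply: supportedN; last by apply: (supportedM (s3 _)); monomials.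
  by apply: supportedMn; apply: (supportedM (s3 _)); monomials.
apply: (etrans every9_recip_mod5).
exact: (class_expansion (phi_split3 _) recip_pow5 every9_recip_class1).
Qed.

(** Fifth powers times phi1 or phi9 are all that contributes to the class of n
    modulo 3, and their exponents are squares modulo 5. *)
Lemma recip_vanish n : n = 1 %[mod 3] -> (n %% 5 == 2)%N || (n %% 5 == 3)%N ->
  B (3 * (3 * n))%N = 0.
Proof.
move=> n3 n5; rewrite -[LHS]/(every 3 (every 3 B) n).
have [E0 [E2 [s0 s2 e]]] := every9_recip_split.
pose y := subXn 3 B.
have inv3 : phi3 * y = 1 by rewrite -subXnM // phiB subXn1.
have sy k : supported 3 0 (y ^+ k).
  have s3 : supported 3 0 y by apply: supported_subXn.
  by have := supportedX (k := k) s3; rewrite mul0n.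
rewrite (recip_cancel_split inv3 e) 2!fpsD.
rewrite (supportedM (sy 60) s0) ?n3 // (supportedM (sy 60) s2) ?n3 // add0r addr0.
rewrite pow5_factor; apply: square_supportedN n5.
have sq9 : square_supported phi9.
  have -> : phi9 = theta_class 'F_5 (0 : 'F_3) by rewrite theta_class0.
  exact: square_supported_theta.
have sq1 : square_supported phi1.
  by apply: square_supportedD; [apply: square_supported_theta | apply: square_supportedN].
by do ![exact: sq1 | exact: sq9 | apply: square_supported_pow5 | apply: square_supportedD].
Qed.
End RecipMod5.

(** * Gauss's product for the theta function *)

Section Shanks.
Variables (A : comNzRingType) (x : A).

Definition prodB m n := \prod_(m <= k < n) (1 - x ^+ k.+1).
Definition prodD n := \prod_(0 <= k < n) (1 + x ^+ k.+1).
Definition gauss_sum n := 1 + (\sum_(0 <= s < n) (-1) ^+ s.+1 * x ^+ (s.+1 ^ 2)) *+ 2.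
Definition shanks_rest n :=
  \sum_(0 <= s < n) (-1) ^+ s.+1 * x ^+ (s.+1 * n.+1) * prodB s.+1 n * prodD s.

Lemma prodB_nn n : prodB n n = 1.
Proof. by rewrite /prodB big_geq. Qed.

Lemma prodBS m n : (m <= n)%N -> prodB m n.+1 = prodB m n * (1 - x ^+ n.+1).
Proof. by move=> lemn; rewrite /prodB big_nat_recr. Qed.

Lemma prodB_ltn m n : (m < n)%N -> prodB m n = (1 - x ^+ m.+1) * prodB m.+1 n.
Proof. by move=> ltmn; rewrite /prodB big_ltn. Qed.

Lemma prodDS n : prodD n.+1 = prodD n * (1 + x ^+ n.+1).
Proof. by rewrite /prodD big_nat_recr. Qed.

(** The telescoping sum behind the induction step of Shanks's identity: adding the
    term of index m on the left replaces the last product by the next one. *)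
Lemma shanks_telescope n m : (m <= n)%N ->
  \sum_(0 <= s < m) (-1) ^+ s.+1 * prodD s *
     (x ^+ (s.+1 * n.+2) * prodB s.+1 n.+1
      - (1 + x ^+ n.+1) * x ^+ (s.+1 * n.+1) * prodB s.+1 n)
  = x ^+ n.+1 * prodB 0 n + (-1) ^+ m.+1 * x ^+ (n.+1 * m.+1) * prodB m n * prodD m.
Proof.
elim: m => [|m IHm] lemn.
  by rewrite big_nil /prodD big_nil muln1; ring.
rewrite big_nat_recr //= IHm 1?ltnW // prodBS // (prodB_ltn lemn) prodDS.
have -> : x ^+ (n.+1 * m.+2) = x ^+ (n.+1 * m.+1) * x ^+ n.+1 by rewrite -exprD -mulnSr.
have -> : x ^+ (m.+1 * n.+2) = x ^+ (n.+1 * m.+1) * x ^+ m.+1.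
  by rewrite -exprD mulnSr mulnC.
rewrite [(m.+1 * n.+1)%N]mulnC.
move: (x ^+ (n.+1 * m.+1)) (x ^+ n.+1) (x ^+ m.+1) (prodB m.+1 n) (prodB 0 n) (prodD m).
by move=> u v w b b0 d; rewrite !exprS; ring.
Qed.

(** Shanks's finite form of Gauss's theorem.  All the terms of the error
    shanks_rest n are divisible by x^(n+1), so that the sum of the
    (-1)^j x^(j^2) agrees with the quotient of the two products up to there. *)
Lemma shanks n : prodD n * gauss_sum n = prodB 0 n + shanks_rest n *+ 2.
Proof.
elim: n => [|n IHn].
  by rewrite /prodD /prodB /gauss_sum /shanks_rest !big_nil; ring.
have tel := shanks_telescope (leqnn n).
have Dn : shanks_rest n.+1 - (1 + x ^+ n.+1) * shanks_rest n =
    x ^+ n.+1 * prodB 0 n + (-1) ^+ n.+1 * x ^+ (n.+1 * n.+1) * prodD n.+1.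
  rewrite {1}/shanks_rest big_nat_recr //= prodB_nn prodDS addrAC.
  have -> : shanks_rest n = \sum_(0 <= s < n)
      (-1) ^+ s.+1 * x ^+ (s.+1 * n.+1) * prodB s.+1 n * prodD s by [].
  rewrite mulr_sumr -sumrB.
  under eq_bigr => s _.
    have -> : (-1) ^+ s.+1 * x ^+ (s.+1 * n.+2) * prodB s.+1 n.+1 * prodD s -
      (1 + x ^+ n.+1) * ((-1) ^+ s.+1 * x ^+ (s.+1 * n.+1) * prodB s.+1 n * prodD s) =
      (-1) ^+ s.+1 * prodD s * (x ^+ (s.+1 * n.+2) * prodB s.+1 n.+1
      - (1 + x ^+ n.+1) * x ^+ (s.+1 * n.+1) * prodB s.+1 n) by ring.
    over.
  rewrite tel prodB_nn.
  have -> : x ^+ (n.+1 * n.+2) = x ^+ (n.+1 * n.+1) * x ^+ n.+1 by rewrite -exprD -mulnSr.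
  by rewrite !exprS; ring.
have -> : gauss_sum n.+1 = gauss_sum n + (-1) ^+ n.+1 * x ^+ (n.+1 ^ 2) *+ 2.
  by rewrite /gauss_sum big_nat_recr //=; ring.
have -> : shanks_rest n.+1 = (1 + x ^+ n.+1) * shanks_rest n
    + (x ^+ n.+1 * prodB 0 n + (-1) ^+ n.+1 * x ^+ (n.+1 * n.+1) * prodD n.+1).
  by rewrite -Dn; ring.
rewrite prodBS // mulrDr {1}prodDS.
transitivity ((1 + x ^+ n.+1) * (prodD n * gauss_sum n)
  + prodD n.+1 * ((-1) ^+ n.+1 * x ^+ (n.+1 ^ 2) *+ 2)); first by ring.
rewrite IHn -mulnn.
by move: (x ^+ n.+1) (x ^+ (n.+1 * n.+1)) => u w; ring.
Qed.
End Shanks.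

(** * Counting overpartitions by their largest part *)

(** Consecutive parts of an overpartition: as the sequence of parts is monotone, a
    part is a first occurrence exactly when it is smaller than its predecessor. *)
Definition precedes (x y : nat * bool) := (y.1 < x.1)%N || ((y.1 == x.1) && ~~ y.2).

Lemma is_overpartitionE n s :
  is_overpartition n s =
  [&& all (fun x => 0 < x.1)%N s, sorted precedes s & sumn (unzip1 s) == n].
Proof.
rewrite /is_overpartition /= all_map; congr (_ && _).
rewrite andbCA [in RHS]andbC; congr (_ && _).
pose p i := (nth (0%N, false) s i).1; pose b i := (nth (0%N, false) s i).2.
have pE i : (i < size s)%N -> nth 0%N (unzip1 s) i = p i.
  by move=> lti; rewrite (nth_map (0%N, false)).
have bE i : (i < size s)%N -> nth false (unzip2 s) i = b i.
  by move=> lti; rewrite (nth_map (0%N, false)).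
have le_index i : (i < size s)%N -> (index (p i) (unzip1 s) <= i)%N.
  by move=> lti; rewrite -pE // index_nth // size_map.
apply/andP/(sortedP (0%N, false)) => [[/(sortedP 0%N) geqs /forallP marks] i lti|prec].
  have := geqs i; rewrite size_map => /(_ lti); rewrite /geq /= (pE _ lti) (pE _ (ltnW lti)).
  rewrite leq_eqVlt /precedes -/(p i) -/(p i.+1) -/(b i.+1) => /orP[/eqP ep|->//].
  rewrite ep eqxx ltnn /=; apply/negP => bi.
  have := marks (Ordinal lti); rewrite /= bE // pE // bi ep => /eqP ei.
  by have := le_index i (ltnW lti); rewrite ei ltnn.
have geqs i : (i.+1 < size s)%N -> (p i.+1 <= p i)%N.
  by move=> /prec; rewrite /precedes -/(p i) -/(p i.+1) => /orP[/ltnW|/andP[/eqP->]].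
have mono i j : (i <= j)%N -> (j < size s)%N -> (p j <= p i)%N.
  elim: j => [|j IHj]; first by rewrite leqn0 => /eqP->.
  rewrite leq_eqVlt => /orP[/eqP->//|leij] ltj.
  exact: leq_trans (geqs j ltj) (IHj leij (ltnW ltj)).
split.
  apply/(sortedP 0%N) => i; rewrite size_map => lti.
  by rewrite /geq /= (pE _ lti) (pE _ (ltnW lti)); apply: geqs.
apply/forallP => -[i lti] /=; rewrite bE // pE //; apply/implyP => bi.
rewrite eqn_leq le_index //= leqNgt; apply/negP => ltji.
case: i lti bi ltji => // i lti bi; rewrite ltnS => leji.
have pj : p (index (p i.+1) (unzip1 s)) = p i.+1.
  have ltj := leq_ltn_trans leji (ltnW lti).
  by rewrite -{1}pE // nth_index // -pE // mem_nth // size_map.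
have := mono _ _ leji (ltnW lti); rewrite pj => le1.
have := prec i lti; rewrite /precedes -/(p i) -/(p i.+1) -/(b i.+1) bi andbF orbF.
by rewrite ltnNge le1.
Qed.

(** path precedes (k, false) s says that all the parts of s are at most k and
    that those equal to k are not overlined. *)
Definition bounded_overp (k n : nat) (s : seq (nat * bool)) :=
  [&& all (fun x => 0 < x.1)%N s, path precedes (k, false) s & sumn (unzip1 s) == n].

(** The first element is either (k, false), or at most (k - 1, false), or
    (k - 1, true).  The fuel bounds k + n. *)
Fixpoint overps (fuel k n : nat) : seq (seq (nat * bool)) :=
  if fuel is f.+1 then
    if k is k'.+1 then
      (if (k <= n)%N then map (cons (k, false)) (overps f k (n - k)) else [::]) ++
      overps f k' n ++
      (if (0 < k' <= n)%N then map (cons (k', true)) (overps f k' (n - k')) else [::])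
    else if n == 0%N then [:: [::]] else [::]
  else [::].

Lemma overpsS f k n :
  overps f.+1 k.+1 n =
    (if (k < n)%N then map (cons (k.+1, false)) (overps f k.+1 (n - k.+1)) else [::]) ++
    overps f k n ++
    (if (0 < k <= n)%N then map (cons (k, true)) (overps f k (n - k)) else [::]).
Proof. by []. Qed.

Lemma bounded_overp0 n s : bounded_overp 0 n s = (s == [::]) && (n == 0%N).
Proof.
case: s => [|[j b] s]; first by rewrite /bounded_overp /= eq_sym.
by rewrite /bounded_overp; case: j => [|j] //=; rewrite ?andbF.
Qed.

Lemma bounded_overpS k n s :
  bounded_overp k.+1 n s =
  match s with
  | [::] => n == 0%N
  | x :: s' =>
     [|| [&& x == (k.+1, false), k.+1 <= n & bounded_overp k.+1 (n - k.+1) s']%N,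
         bounded_overp k n s |
         [&& x == (k, true), 0 < k <= n & bounded_overp k (n - k) s']%N]
  end.
Proof.
case: s => [|[j b] s]; first by rewrite /bounded_overp /= eq_sym.
have pathb c : path precedes (j, c) s = path precedes (j, false) s by case: s.
have sumE m : (j + m == n)%N = (j <= n)%N && (m == n - j)%N.
  by apply/eqP/andP => [<-|[lejn /eqP->]]; rewrite ?leq_addr ?addKn ?subnKC.
rewrite /bounded_overp /= pathb sumE /precedes /= !xpair_eqE.
have [ltjk|ltkj|ejk] := ltngtP j k; last first.
- move: sumE pathb; rewrite ejk => _ _; rewrite ltnSn ltn_eqF //.
  by case: b; case: (0 < k)%N; case: (k <= n)%N; rewrite /= ?andbF ?orbF.
- have [ejk|nejk] := eqVneq j k.+1; last first.
    have -> : (j < k.+1)%N = false by apply/negP; rewrite ltnS leqNgt ltkj.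
    by rewrite !andbF.
  rewrite ejk ltnn.
  by case: b; case: (k < n)%N; rewrite /= ?andbF ?orbF.
- have ltjk1 := ltn_trans ltjk (ltnSn k).
  by rewrite ltjk1 (ltn_eqF ltjk1) /= orbF.
Qed.

Lemma mem_overps f k n s : (k + n < f)%N -> (s \in overps f k n) = bounded_overp k n s.
Proof.
elim: f k n s => // f IHf [|k] n s ltf.
  by rewrite /= bounded_overp0; case: (n == 0%N); rewrite ?inE ?andbT ?andbF.
have IH1 := IHf k n _ ltf.
have consP (y x : nat * bool) t (m : seq (seq (nat * bool))) :
    (x :: t \in [seq y :: i | i <- m]) = (x == y) && (t \in m).
  apply/mapP/andP => [[u um [-> ->]]|[/eqP-> tm]]; first by rewrite eqxx.
  by exists t.
have nilP (y : nat * bool) (m : seq (seq (nat * bool))) :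
    ([::] \in [seq y :: i | i <- m]) = false.
  by apply/negP => /mapP[].
have ifP' (b : bool) (m : seq (seq (nat * bool))) t :
    (t \in if b then m else [::]) = b && (t \in m) by case: b.
rewrite bounded_overpS /= !mem_cat !ifP' IH1.
case: s => [|x s]; first by rewrite !nilP /bounded_overp /= !andbF orbF eq_sym.
rewrite !consP; congr [|| _, _ | _].
  rewrite andbCA; congr (_ && _); case: leqP => //= lekn.
  by rewrite IHf // subnKC // (leq_ltn_trans (leq_addl k n)).
rewrite andbCA; congr (_ && _); case: ltnP => //= k0; case: leqP => //= lekn.
by rewrite IHf // subnKC // (leq_ltn_trans (leq_addl k n)).
Qed.

Lemma overps_uniq f k n : (k + n < f)%N -> uniq (overps f k n).
Proof.
elim: f k n => // f IHf [|k] n ltf; first by rewrite /=; case: eqP.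
have nf : (n < f)%N := leq_ltn_trans (leq_addl k n) ltf.
rewrite /= !cat_uniq; apply/and4P; split.
- case: leqP => // lekn; rewrite map_inj_uniq => [|? ? []//].
  by apply: IHf; rewrite subnKC.
- apply/hasPn => s; rewrite mem_cat => /orP[|].
    rewrite mem_overps // => /and3P[_ prec _]; case: leqP => // _.
    apply/mapP => -[t _ es]; move: prec; rewrite es /= /precedes /=.
    by rewrite ltnNge leqnSn gtn_eqF.
  case: ifP => // _ /mapP[t _ ->]; case: leqP => // _.
  by apply/mapP => -[t' _ []].
- exact: IHf.
- apply/andP; split.
    apply/hasPn => s; case: ifP => // _ /mapP[t _ ->].
    by rewrite mem_overps // /bounded_overp /= /precedes /= ltnn andbF andbF.
  case: ifP => // /andP[_ lekn]; rewrite map_inj_uniq => [|? ? []//].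
  by apply: IHf; rewrite subnKC.
Qed.

Definition count_overps k n := size (overps (k + n).+1 k n).

Lemma count_overpsE f k n : (k + n < f)%N -> size (overps f k n) = count_overps k n.
Proof.
move=> ltf; apply/perm_size/uniq_perm; try exact: overps_uniq.
by move=> s; rewrite !mem_overps.
Qed.

Lemma count_overps0 n : count_overps 0 n = (n == 0%N).
Proof. by rewrite /count_overps /=; case: eqP. Qed.

Lemma count_overpsS k n :
  count_overps k.+1 n =
    ((if k < n then count_overps k.+1 (n - k.+1) else 0) + count_overps k n
     + (if 0 < k <= n then count_overps k (n - k) else 0))%N.
Proof.
rewrite {1}/count_overps addSn overpsS !size_cat addnA; congr (_ + _ + _)%N.
- case: ifP => // lekn; rewrite size_map count_overpsE // subnKC //.
  by rewrite ltnS leq_addl.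
- case: ifP => // /andP[_ lekn]; rewrite size_map count_overpsE // subnKC //.
  by rewrite ltnS leq_addl.
Qed.

(** A first part of size k + 1 is impossible when n is at most k. *)
Lemma overpE k n : (n <= k)%N -> overp n = count_overps k.+1 n.
Proof.
move=> lenk; rewrite /overp cardE -(size_map (@forget_bounds n)).
apply/perm_size/uniq_perm.
- by rewrite map_inj_uniq ?enum_uniq //; apply: forget_bounds_inj.
- exact: overps_uniq.
move=> s; rewrite mem_overps //.
have -> : bounded_overp k.+1 n s = is_overpartition n s.
  rewrite is_overpartitionE /bounded_overp; congr (_ && _).
  case: s => [|x s] //=; case: eqP => [es|_]; last by rewrite !andbF.
  rewrite !andbT {1}/precedes ltnS (leq_trans _ lenk) // -es.
  exact: leq_addr.
apply/mapP/idP => [[t]|os].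
  by rewrite mem_enum inE => ot ->.
have [t st] := overpartition_bounded os; exists t => //.
by rewrite mem_enum inE -st.
Qed.

Section OverpSeries.
Variable R : comNzRingType.
Local Notation X := (fpsX R).
Local Notation x := (- fpsX R).
Local Notation phi := (theta R predT).

Lemma fps_sign k (f : fps R) n : ((-1) ^+ k * f) n = (-1) ^+ k * f n.
Proof. by elim: k f => [|k IHk] f; rewrite ?mul1r // !exprS -!mulrA !mulN1r -IHk. Qed.

Lemma fps_oppXnM k (f : fps R) n :
  (x ^+ k * f) n = if (k <= n)%N then (-1) ^+ k * f (n - k)%N else 0.
Proof.
rewrite (exprNn X) -mulrA fps_sign fpsXnM; case: ifP => // _.
by rewrite mulr0.
Qed.

(** The sign makes x = - q the natural variable: in terms of x these are the
    generating functions without sign. *)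
Definition overp_series : fps R := Fps (fun n => (-1) ^+ n * (overp n)%:R).
Definition bounded_series k : fps R := Fps (fun n => (-1) ^+ n * (count_overps k n)%:R).

Lemma bounded_series0 : bounded_series 0 = 1.
Proof.
apply: fpsP => n; rewrite fps1 /= count_overps0.
by case: n => [|n]; rewrite ?mulr0 ?mulr1.
Qed.

Lemma fps_oppXn_bounded j k n :
  (x ^+ j * bounded_series k) n =
    (-1) ^+ n * (if j <= n then count_overps k (n - j) else 0)%N%:R.
Proof.
rewrite fps_oppXnM; case: ifP => [lejn|_]; last by rewrite mulr0.
by rewrite /= mulrA -exprD subnKC.
Qed.

Lemma bounded_seriesS k :
  (1 - x ^+ k.+1) * bounded_series k.+1 =
    (if k == 0%N then 1 else 1 + x ^+ k) * bounded_series k.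
Proof.
rewrite mulrBl mul1r; apply: fpsP => n; rewrite fpsD fpsN fps_oppXn_bounded.
rewrite [bounded_series _ _]/= count_overpsS -mulrBr.
case: k => [|k].
  by rewrite mul1r /= addn0 natrD addrAC subrr add0r.
rewrite mulrDl mul1r fpsD fps_oppXn_bounded /= -mulrDr.
by rewrite !natrD addrAC [X in X + _]addrAC subrr add0r.
Qed.

Lemma prodB_bounded K : prodB x 0 K.+1 * bounded_series K.+1 = prodD x K.
Proof.
elim: K => [|K IHK].
  by rewrite prodBS // prodB_nn mul1r bounded_seriesS mul1r bounded_series0 /prodD big_nil.
by rewrite prodBS // -mulrA bounded_seriesS /= mulrCA IHK prodDS mulrC.
Qed.

Lemma shanks_rest_factor n : exists w, shanks_rest x n = x ^+ n.+1 * w.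
Proof.
exists (\sum_(0 <= s < n) (-1) ^+ s.+1 * x ^+ (s * n.+1) * prodB x s.+1 n * prodD x s).
rewrite mulr_sumr; apply: eq_bigr => s _.
have -> : x ^+ (s.+1 * n.+1) = x ^+ n.+1 * x ^+ (s * n.+1) by rewrite -exprD mulSn.
by ring.
Qed.

Lemma gauss_sum_theta n : eq_below n phi (gauss_sum x n).
Proof.
move=> m ltmn; rewrite (@theta_box _ _ n m ltmn); congr (coef _ m) => {m ltmn}.
elim: n => [|n IHn]; first by rewrite /gauss_sum big_nil mul0rn (_ : ints 0 = [:: 0]) // big_cons big_nil.
have -> : gauss_sum x n.+1 = gauss_sum x n + X ^+ (n.+1 ^ 2) *+ 2.
  rewrite /gauss_sum big_nat_recr //= mulrnDl addrA; congr (_ + _ *+ _).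
  by rewrite [x ^+ _]exprNn mulrA -exprD -signr_odd oddD oddX /= addbb mul1r.
rewrite -IHn (perm_big (n.+1%:Z :: - n.+1%:Z :: ints n)) /=.
  rewrite !big_cons /= sqzN /sqz absz_nat; ring.
apply: uniq_perm; first exact: ints_uniq.
  by rewrite 2!cons_uniq ints_uniq in_cons !mem_ints; lia.
by move=> y; rewrite mem_ints 2!in_cons mem_ints; lia.
Qed.

Lemma prodD_0 n : prodD x n 0%N = 1.
Proof.
elim: n => [|n IHn]; first by rewrite /prodD big_nil.
by rewrite prodDS fps_mul0 IHn mul1r fpsD fps_exp0 fpsN /= oppr0 expr0n addr0.
Qed.

(** Modulo q^(n+1), the identity of Shanks says that phi is the product of the
    quotients (1 - x^k) / (1 + x^k) for x = - q, and prodB_bounded says that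
    overp_series is the product of their inverses. *)
Lemma theta_overp : phi * overp_series = 1.
Proof.
apply: fpsP => n.
have eN : eq_below n.+1 overp_series (bounded_series n.+1).
  by move=> m; rewrite ltnS => lemn /=; rewrite (overpE lemn).
rewrite (eq_belowM (@gauss_sum_theta n.+1) eN) //.
apply/eqP; rewrite -subr_eq0 -fpsB -[X in _ == X](fps0 _ n); apply/eqP.
apply: (@fps_mul_low _ n.+1 (prodD x n)) => //; first exact: prodD_0.
have [w restE] := shanks_rest_factor n.+1.
have sh : prodD x n.+1 * gauss_sum x n.+1 * bounded_series n.+1 =
    prodD x n + x ^+ n.+2 * (w *+ 2 * bounded_series n.+1).
  rewrite shanks restE mulrDl prodB_bounded.
  by ring.
have -> : prodD x n * (gauss_sum x n.+1 * bounded_series n.+1 - 1) =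
    x ^+ n.+1 * (x * (w *+ 2 * bounded_series n.+1)
                 - prodD x n * gauss_sum x n.+1 * bounded_series n.+1).
  transitivity (prodD x n.+1 * gauss_sum x n.+1 * bounded_series n.+1 - prodD x n
    - x ^+ n.+1 * (prodD x n * gauss_sum x n.+1 * bounded_series n.+1)).
    by rewrite prodDS; ring.
  by rewrite sh (exprSr x n.+1); ring.
by move=> m ltmn; rewrite fps_oppXnM leqNgt ltmn fps0.
Qed.
End OverpSeries.

(** * Overpartitions modulo 8 and modulo 5 *)

Section Mod8.
Local Notation series := (fps 'Z_8).
Local Notation phi := (theta 'Z_8 predT).
Local Notation psi := (theta 'Z_8 (fun x => 0 < x)).
Local Notation B := (overp_series 'Z_8).

Lemma theta_eq0 (R : comNzRingType) (P : pred int) n :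
  (forall x, P x -> sqz x != n) -> theta R P n = 0.
Proof.
move=> Pn; rewrite /theta /= fps_sum big1 // => x /Pn xn.
by rewrite fpsXn eq_sym (negbTE xn).
Qed.

Lemma thetaID (R : comNzRingType) (P Q : pred int) :
  theta R P = theta R (fun x => P x && Q x) + theta R (fun x => P x && ~~ Q x).
Proof. by apply: fpsP => n; rewrite fpsD /theta /= -fpsD -bigID. Qed.

Lemma theta_pred0 (R : comNzRingType) : theta R (fun x => x == 0) = 1.
Proof.
apply: fpsP => n; transitivity (coef (fpsX R ^+ sqz 0) n) => //.
rewrite -[LHS]/((\sum_(x <- ints n | x == 0) fpsX R ^+ sqz x) n).
congr (coef _ n); rewrite (big_rem 0) ?mem_ints // eqxx big1_seq => [|x].
  exact: addr0.
by rewrite mem_rem_uniq ?ints_uniq // !inE => /and3P[/eqP-> /eqP].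
Qed.

Lemma theta_posE : phi = 1 + psi *+ 2.
Proof.
rewrite (thetaID _ _ (fun x => x == 0)) /= theta_pred0; congr (_ + _).
rewrite (thetaID _ _ (fun x => 0 < x)) mulr2n; congr (_ + _).
  by apply: eq_theta => x /=; lia.
by rewrite -[RHS]theta_opp; apply: eq_theta => x /=; lia.
Qed.

Lemma psi_idem n : psi n ^+ 2 = psi n.
Proof.
have -> : psi n = (count (fun x : int => (0 < x) && (sqz x == n)) (ints n))%:R := vector_sum_count _ _ _ _ _.
rewrite -size_filter.
have := filter_uniq (fun x : int => (0 < x) && (sqz x == n)) (ints_uniq n).
have : all (fun x : int => (0 < x) && (sqz x == n))
  [seq x <- ints n | (0 < x) && (sqz x == n)] by apply: filter_all.
case: filter => [|x [|y s]] /=; rewrite ?expr0n ?expr1n //.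
case/and3P=> /andP[x0 /eqP xn] /andP[y0 /eqP yn] _.
have -> : x = y by move: xn; rewrite -yn /sqz; nia.
by rewrite inE eqxx.
Qed.

Lemma eight0 : 8%:R = 0 :> 'Z_8. Proof. exact/eqP. Qed.

(** (1 + 2 psi) (1 - 2 psi + 4 psi^2) = 1 + 8 psi^3. *)
Lemma overp_series_mod8 : B = 1 - psi *+ 2 + subXn 2 psi *+ 4.
Proof.
have phi0 : phi 0%N = 1 := phi_0 _.
apply: (fps_mulI phi0); rewrite theta_overp.
have <- : psi ^+ 2 *+ 4 = subXn 2 psi *+ 4.
  by apply: fps_frobenius => //; [exact: eight0 | exact: psi_idem].
have fps8 : 8%:R = 0 :> series.
  by apply: fpsP => n; rewrite fpsMn fps1 fps0; case: eqP => _; rewrite ?eight0 ?mul0rn.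
transitivity (1 + 8%:R * psi ^+ 3); first by rewrite fps8 mul0r addr0.
by rewrite theta_posE; ring.
Qed.

Lemma dvdn_overp8 n :
  (forall m, n != m ^ 2)%N -> (forall m, n != 2 * m ^ 2)%N -> (8 %| overp n)%N.
Proof.
move=> nsq n2sq.
have : B n = 0.
  rewrite overp_series_mod8 fpsD (fpsD 1) fpsN !fpsMn fps1 subXnE.
  have -> : psi n = 0.
    by apply: theta_eq0 => x _; rewrite eq_sym; exact: nsq.
  case: eqP => [n0|_]; first by have := nsq 0%N; rewrite n0.
  case: ifP => [/dvdnP[k nk]|_]; rewrite ?mul0rn ?oppr0 ?addr0 //.
  rewrite theta_eq0 ?mul0rn ?addr0 // => x _.
  by have := n2sq `|x|%N; rewrite nk mulnK // mulnC eqn_pmul2l // eq_sym.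
rewrite /= => /(congr1 (fun y => (-1) ^+ n * y)).
rewrite mulrA -exprD addnn -signr_odd odd_double mul1r mulr0.
by move=> /(congr1 val); rewrite /= val_Zp_nat // => /eqP.
Qed.
End Mod8.

Lemma dvdn_overp5 n :
  (n = 1 %[mod 3])%N -> (n %% 5 == 2)%N || (n %% 5 == 3)%N -> (5 %| overp (9 * n))%N.
Proof.
move=> n3 n5; have := recip_vanish (theta_overp 'F_5) n3 n5.
rewrite mulnA /= => /(congr1 (fun y => (-1) ^+ (9 * n) * y)).
rewrite mulrA -exprD addnn -signr_odd odd_double mul1r mulr0.
by move/eqP; rewrite -(dvdn_pcharf (pchar_Fp (isT : prime 5))).
Qed.

(** * The congruence modulo 40 *)

Lemma dvdn_overp40 n :
  (n = 1 %[mod 3])%N -> (n %% 5 == 2)%N || (n %% 5 == 3)%N -> (40 %| overp (9 * n))%N.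
Proof.
move=> n3 n5; rewrite (@Gauss_dvd 5 8) // dvdn_overp5 //= dvdn_overp8 // => m.
  apply/eqP => e; move: n5.
  have {e} : (9 * n = m ^ 2 %[mod 5])%N by rewrite e.
  rewrite -modnXm -modnMm.
  have := ltn_pmod m (isT : 0 < 5)%N; have := ltn_pmod n (isT : 0 < 5)%N.
  by case: (n %% 5)%N => [|[|[|[|[|]]]]] //; case: (m %% 5)%N => [|[|[|[|[|]]]]].
apply/eqP => e.
have /dvdnP[k mk] : (3 %| m)%N.
  have : (3 %| 2 * m ^ 2)%N by rewrite -e dvdn_mulr.
  by rewrite Gauss_dvdr // Euclid_dvdX // andbT.
have nk : n = (2 * k ^ 2)%N by apply/eqP; rewrite -(eqn_pmul2l (isT : 0 < 9)%N) e mk; lia.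
move: n3; rewrite nk -modnMmr -modnXm.
by have := ltn_pmod k (isT : 0 < 3)%N; case: (k %% 3)%N => [|[|[|]]].
Qed.

Local Close Scope ring_scope.

Theorem theorem3p4 (n : nat) :
  (overp (135 * n + 63) = 0 %[mod 40]) /\
  (overp (135 * n + 117) = 0 %[mod 40]).
Proof.
have cong k : (k = 1 %[mod 3]) -> (k %% 5 == 2) || (k %% 5 == 3) ->
    overp (9 * k) = 0 %[mod 40].
  by move=> k3 k5; apply/eqP; rewrite mod0n; apply: dvdn_overp40.
split.
  have -> : 135 * n + 63 = 9 * (15 * n + 7) by lia.
  by apply: cong; lia.
have -> : 135 * n + 117 = 9 * (15 * n + 13) by lia.
by apply: cong; lia.
Qed.
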